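(* Let $E_1$, $E_2$ and $F$ be locally convex spaces, $U\subseteq E_1$ and $V\subseteq E_2$ be locally convex subsets with dense interior, and $r,s\in \mathbb{N}_0\cup\{\infty\}$. Then for each $\gamma\in C^{r,s}(U\times V,F)$ the map $\gamma^\vee\colon U\to C^s(V,F)$, $x\mapsto \gamma(x,\bullet)$ is $C^r$, and the map $$\Phi\colon C^{r,s}(U\times V,F)\to C^r(U,C^s(V,F)),\quad \gamma\mapsto \gamma^\vee$$ is linear and a topological embedding. If $U\times V\times E_1\times E_2$ is a k-space or $V$ is locally compact, then $\Phi$ is an isomorphism of topological vector spaces.
   Context: Locally convex spaces are real Hausdorff locally convex topological vector spaces. A subset $U$ of a locally convex space $E$ is called locally convex if every $x\in U$ has a convex neighbourhood in $U$. ''With dense interior'' means that the interior $U^\circ$ is dense in $U$. $C^r$-maps: For $f\colon U\to F$ with $U\subseteq E$ open, $D_hf(x):=\lim_{t\to0}t^{-1}(f(x+th)-f(x))$. The map $f$ is $C^r$ ($r\in\mathbb{N}_0\cup\{\infty\}$) if for all $k\in\mathbb{N}_0$ with $k\le r$ the iterated directional derivatives $d^{(k)}f(x,y_1,\dots,y_k):=(D_{y_k}\cdots D_{y_1}f)(x)$ exist and define a continuous map $d^{(k)}f\colon U\times E^k\to F$. If $U$ is a locally convex subset with dense interior, $f\colon U\to F$ is $C^r$ if $f|_{U^\circ}$ is $C^r$ and each $d^{(k)}(f|_{U^\circ})$ extends to a (unique) continuous map $d^{(k)}f\colon U\times E^k\to F$ (with $d^{(0)}f=f$). $C^{r,s}$-maps: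 For $U\subseteq E_1$, $V\subseteq E_2$ open, $f\colon U\times V\to F$ is $C^{r,s}$ if for all $i,j\in\mathbb{N}_0$ with $i\le r$, $j\le s$ the iterated directional derivative $$d^{(i,j)}f(x,y,w_1,\dots,w_i,v_1,\dots,v_j):=(D_{(w_i,0)}\cdots D_{(w_1,0)}D_{(0,v_j)}\cdots D_{(0,v_1)}f)(x,y)$$ exists for all $x\in U,y\in V,w_a\in E_1,v_b\in E_2$ and $d^{(i,j)}f\colon U\times V\times E_1^i\times E_2^j\to F$ is continuous. If $U,V$ are locally convex subsets with dense interior, $f$ is $C^{r,s}$ if $f|_{U^\circ\times V^\circ}$ is $C^{r,s}$ and each $d^{(i,j)}(f|_{U^\circ\times V^\circ})$ ($i\le r$, $j\le s$) extends to a continuous map $d^{(i,j)}f\colon U\times V\times E_1^i\times E_2^j\to F$ (with $d^{(0,0)}f=f$). Topologies: $C^r(U,F)$, the space of $C^r$-maps $U\to F$, carries the initial topology with respect to the maps $d^{(k)}\colon C^r(U,F)\to C(U\times E^k,F)$, $k\le r$; $C^{r,s}(U\times V,F)$, the space of $C^{r,s}$-maps, carries the initial topology with respect to the maps $d^{(i,j)}\colon C^{r,s}(U\times V,F)\to C(U\times V\times E_1^i\times E_2^j,F)$, $i\le r$, $j\le s$. Here spaces $C(\cdot,F)$ of continuous maps carry the compact-open topology. A topological space $X$ is a k-space if it is Hausdorff and its topology is the final topology with respect to the inclusion maps $K\to X$ of compact subsets $K\subseteq X$. *)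

(* Defs.v *)
From HB Require Import structures.
From mathcomp Require Import all_boot all_order all_algebra.
From mathcomp Require Import all_classical all_reals all_analysis.

Set Implicit Arguments.
Unset Strict Implicit.
Unset Printing Implicit Defensive.

Import Order.TTheory GRing.Theory Num.Theory.
Import numFieldTopology.Exports.

Local Open Scope classical_set_scope.
Local Open Scope ring_scope.

HB.mixin Record Topological_isHausdorff T & Topological T := {
  hausdorff_spaceT : hausdorff_space T }.

#[short(type="lcsType")]
HB.structure Definition LocallyConvexSpace (R : realType) :=
  {E of Tvs R E & Topological_isHausdorff E}.

Local Lemma nbhs0_shift (M : topologicalZmodType) (v : M) (A : set M) :
  nbhs v A -> nbhs (0 : M) [set w | A (v + w)].
Proof.
move=> nA; have := @add_continuous M (v, 0); rewrite /continuous_at /= addr0.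
move=> /(_ _ nA) [[B C] /= [nB nC] BC].
apply: filterS nC => w Cw; apply: (BC (v, w)); split => //=.
exact: nbhs_singleton.
Qed.

Local Lemma nbhs_shift (M : topologicalZmodType) (v : M) (A : set M) :
  nbhs (0 : M) A -> nbhs v [set w | A (w - v)].
Proof.
move=> nA; have := @sub_continuous M (v, v); rewrite /continuous_at /= subrr.
move=> /(_ _ nA) [[B C] /= [nB nC] BC].
apply: filterS nB => w Bw; apply: (BC (w, v)); split => //=.
exact: nbhs_singleton.
Qed.

Local Lemma nbhs0_split (M : topologicalZmodType) (A : set M) : nbhs (0 : M) A ->
  exists2 B, nbhs (0 : M) B & forall x y, B x -> B y -> A (x + y).
Proof.
move=> nA; have := @add_continuous M (0, 0); rewrite /continuous_at /= addr0.
move=> /(_ _ nA) [[B C] /= [nB nC] BC]; exists (B `&` C); first exact: filterI.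
by move=> x y [Bx _] [_ Cy]; exact: (BC (x, y)).
Qed.

(* The initial topology on W with respect to the maps [d i], the target
   function spaces carrying the compact-open topology. Below, each [d i] takes
   its values in C(X i, F), whose compact-open topology is induced by that of
   {compact-open, X i -> F}. *)
Definition compact_open_initial (R : realType) (W : lmodType R) (F : lcsType R)
  (I : Type) (X : I -> topologicalType) (d : forall i, W -> X i -> F) : Type := W.
Arguments compact_open_initial {R W F I X} d.

Section compact_open_initial.
Context (R : realType) (W : lmodType R) (F : lcsType R).
Context (I : Type) (X : I -> topologicalType) (d : forall i, W -> X i -> F).
Local Arguments d : clear implicits.

Local Notation T := (compact_open_initial d).

HB.instance Definition _ := GRing.Lmodule.on T.
HB.instance Definition _ := Topological.copy T
  (sup_topology (fun i => Topological.class
    (initial_topology (d i : W -> {compact-open, X i -> F})))).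

Hypothesis dlin : forall i a f g x, d i (a *: f + g) x = a *: d i f x + d i g x.
Local Arguments dlin : clear implicits.
Hypothesis dcont : forall i f, continuous (d i f).
Hypothesis dsep : forall f g, (forall i x, d i f x = d i g x) -> f = g.

Local Lemma compact_open_initial_cvgP (G : set_system T) (f : T) : Filter G ->
  G --> f <-> forall i (K : set (X i)) (A : set F), compact K ->
    nbhs (0 : F) A -> \forall g \near G, forall x, K x -> A (d i g x - d i f x).
Proof.
move=> FG; split; last first.
  move=> H; apply/cvg_sup => i A /=.
  rewrite (@nbhsE (initial_topology (d i : W -> {compact-open, X i -> F}))).
  case=> _ [[C oC <-] Cf] CA.
  apply: (@filterS _ _ _ _ _ CA).
  have : nbhs (d i f : {compact-open, X i -> F}) C by apply: open_nbhs_nbhs.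
  suff : (d i @ G) --> (d i f : {compact-open, X i -> F}) by apply.
  apply/compact_open_cvgP => K O cK oO fKO.
  have nO x : K x -> nbhs (d i f x) O.
    by move=> Kx; apply: open_nbhs_nbhs; split => //; apply: fKO; exists x.
  have : \forall w \near nbhs (0 : F), K `<=` [set x | O (d i f x + w)].
    move/compact_near_coveringP : cK; apply => x Kx.
    have := @add_continuous F (d i f x, 0); rewrite /continuous_at /= addr0.
    move=> /(_ _ (nO x Kx)) [[B D] /= [nB nD] BD].
    exists (d i f @^-1` B, D); first by split => //; exact: dcont.
    by move=> [x' w] /= [Bx' Dw]; exact: (BD (_, _)).
  move=> nw; have := H i K _ cK nw.
  by apply: filterS => g Hg _ [x Kx <-]; have /= := Hg x Kx x Kx; rewrite addrC subrK.
move=> /cvg_sup cG i K A cK nA.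
have {}cG : (d i @ G) --> (d i f : {compact-open, X i -> F}).
  apply: cvg_trans (cvg_app _ (cG i)) _.
  exact: (@initial_continuous W {compact-open, X i -> F} (d i)).
move/compact_open_cvgP : cG => cG.
have [B nB BA] := nbhs0_split nA.
have nNB : nbhs (0 : F) [set w | B (- w)].
  have := @opp_continuous F 0; rewrite /continuous_at oppr0; exact.
move/compact_near_coveringP/near_covering_withinP : (cK); apply => x Kx.
pose D := [set w | B (w - d i f x) /\ B (- (w - d i f x))].
have nD : nbhs (d i f x) D.
  by apply: filterI; [exact: nbhs_shift|exact: (nbhs_shift _ nNB)].
have [C nC CD] : filter_from (nbhs (d i f x)) closure D°.
  by apply: uniform_regular; exact: nbhs_interior.
pose K' := K `&` (d i f @^-1` closure C).
have cK' : compact K'.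
  apply: compact_closedI => //; apply: preimage_closed; last exact: closed_closure.
  by move=> y _; exact: dcont.
have fK' : d i f @` K' `<=` D°.
  by move=> _ [y [Ky Cy] <-]; exact: CD.
have := cG K' D° cK' (open_interior _) fK'.
rewrite nbhs_simpl /= => GD.
exists (d i f @^-1` C, [set g | d i g @` K' `<=` D°]); first split => //=.
  exact: dcont.
move=> [y g] /= [Cy gD] Ky.
have K'y : K' y by split => //; exact: subset_closure.
have [/= Dg _] := interior_subset (gD _ (ex_intro2 _ _ y K'y erefl)).
have [/= _ Df] := interior_subset (fK' _ (ex_intro2 _ _ y K'y erefl)).
have := BA _ _ Dg Df.
by rewrite opprB addrA subrK.
Qed.

Local Lemma compact_open_initial_nbhs (h : T) i (K : set (X i)) (A : set F) :
  compact K -> nbhs (0 : F) A ->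
  nbhs h [set g : T | forall x, K x -> A (d i g x - d i h x)].
Proof.
move=> cK nA.
have FF := @nbhs_filter T h.
by have /(compact_open_initial_cvgP h FF) := @cvg_refl _ (nbhs h); exact.
Qed.

Local Lemma compact_open_initial_dD i (f g : W) x :
  d i (f + g) x = d i f x + d i g x.
Proof. by rewrite -[f in LHS]scale1r dlin scale1r. Qed.

Local Lemma compact_open_initial_dZ i a (f : W) x :
  d i (a *: f) x = a *: d i f x.
Proof.
have d0 : d i 0 x = 0.
  by apply: (@addIr _ (d i 0 x)); rewrite -compact_open_initial_dD addr0 add0r.
by rewrite -[a *: f]addr0 dlin d0 addr0.
Qed.

Local Lemma compact_open_initial_add : continuous (fun p : T * T => p.1 + p.2).
Proof.
move=> [f g]; apply/compact_open_initial_cvgP => i K A cK nA.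
have [B nB BA] := nbhs0_split nA.
exists ([set f' | forall x, K x -> B (d i f' x - d i f x)],
        [set g' | forall x, K x -> B (d i g' x - d i g x)]).
  by split; exact: compact_open_initial_nbhs.
move=> [f' g'] /= [Bf Bg] x Kx.
by rewrite !compact_open_initial_dD opprD addrACA; apply: BA; [exact: Bf|exact: Bg].
Qed.

Local Lemma compact_open_initial_scale :
  continuous (fun p : R^o * T => p.1 *: p.2).
Proof.
move=> [a f]; apply/compact_open_initial_cvgP => i K A cK nA.
have [B nB BA] := nbhs0_split nA.
have [[C D] /= [nC nD] CD] : nbhs ((a : R^o), (0 : F)) [set q | B (q.1 *: q.2)].
  by apply: (@scale_continuous _ F (a, 0)); rewrite /= scaler0.
have nf : \forall g \near f, forall x, K x -> D (d i g x - d i f x).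
  exact: compact_open_initial_nbhs.
have na : \forall b \near nbhs (a : R^o),
    K `<=` [set x | B ((b - a) *: d i f x)].
  move/compact_near_coveringP : cK.
  move=> /(_ R^o (nbhs (a : R^o)) (fun b x => B ((b - a) *: d i f x))).
  apply => x Kx.
  have [[P Q] /= [nP nQ] PQ] :
      nbhs ((0 : R^o), d i f x) [set q | B (q.1 *: q.2)].
    by apply: (@scale_continuous _ F (0, d i f x)); rewrite /= scale0r.
  exists (d i f @^-1` Q, [set b | P (b - a)]).
    by split; [exact: dcont|exact: (@nbhs_shift R^o)].
  by move=> [x' b] /= [Qx Pb]; exact: (PQ (_, _)).
exists (C `&` [set b | K `<=` [set x | B ((b - a) *: d i f x)]],
        [set g | forall x, K x -> D (d i g x - d i f x)]).
  by split => //; exact: filterI.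
move=> [b g] /= [[Cb Bb] Dg] x Kx.
rewrite !compact_open_initial_dZ (_ : b *: d i g x - a *: d i f x =
  b *: (d i g x - d i f x) + (b - a) *: d i f x); last first.
  by rewrite scalerBr scalerBl addrA subrK.
by apply: BA; [apply: (CD (_, _)); split => //; exact: Dg|exact: Bb].
Qed.

Local Lemma compact_open_initial_hausdorff : hausdorff_space T.
Proof.
move=> f g fg; apply: dsep => i x; apply: hausdorff_spaceT => A B nA nB.
have near_ (h : T) (C : set F) : nbhs (d i h x) C ->
    nbhs h [set h' : T | C (d i h' x)].
  move=> nC; have := compact_open_initial_nbhs h (@compact_set1 _ x) (nbhs0_shift nC).
  by apply: filterS => h' /(_ x erefl) /=; rewrite addrC subrK.
have [h [Ah Bh]] := fg _ _ (near_ _ _ nA) (near_ _ _ nB).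
by exists (d i h x).
Qed.

Local Lemma compact_open_initial_convex :
  exists2 B : set_system T, (forall b, b \in B -> convex_set b) & basis B.
Proof.
exists [set b : set T | open b /\ convex_set b].
  by move=> b; rewrite inE => -[].
split; first by move=> b [].
move=> f N nN.
pose G : set_system T := filter_from
  [set b : set T | [/\ open b, convex_set b & b f]] id.
have FG : Filter G.
  apply: filter_from_filter.
    exists setT => //; split; [exact: openT|move=> x y l _ _; exact: mem_set|by []].
  move=> b c [ob cb bf] [oc cc cf]; exists (b `&` c) => //.
  split; [exact: openI| |by []] => x y l.
  rewrite !inE => -[bx cx] [by_ cy].
  by split; apply/set_mem; [apply: cb|apply: cc]; exact/mem_set.
suff Gf : G --> f.
  by have [b [ob cb bf] bN] := Gf N nN; exists b.
apply/compact_open_initial_cvgP => i K A cK nA.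
have [Bs Bs_convex [Bs_open Bs_basis]] := @locally_convex R F.
have [A' [BsA' A'0 A'A]] := Bs_basis 0 A nA.
pose b : set T := [set g | forall x, K x -> A' (d i g x - d i f x)].
exists b; last by move=> g bg x Kx; apply: A'A; exact: bg.
split; last by move=> x Kx; rewrite subrr.
- rewrite openE => g bg; rewrite /interior.
  have nw : \forall w \near (0 : F), K `<=` [set x | A' (d i g x - d i f x + w)].
    move/compact_near_coveringP : cK; apply => x Kx.
    have : nbhs (d i g x - d i f x) A'.
      by apply: open_nbhs_nbhs; split; [exact: Bs_open|exact: bg].
    have := @add_continuous F (d i g x - d i f x, 0).
    rewrite /continuous_at /= addr0 => /[apply] -[[B D] /= [nB nD] BD].
    have : d i g y - d i f y @[y --> x] --> d i g x - d i f x.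
      apply: (@continuous_comp _ _ _ (fun y => (d i g y, d i f y))
        (fun q : F * F => q.1 - q.2)); last exact: sub_continuous.
      by apply: cvg_pair; exact: dcont.
    move=> /(_ B nB) nx.
    exists ([set y | B (d i g y - d i f y)], D); first by split.
    by move=> [y w] /= [By Dw]; exact: (BD (_, _)).
  have := compact_open_initial_nbhs g cK nw; apply: filterS => h /= Hh x Kx.
  by have /= := Hh x Kx x Kx; rewrite addrC addrA subrK.
- move=> g h l; rewrite !inE => bg bh x Kx.
  have /set_mem := Bs_convex _ (mem_set BsA') (d i g x - d i f x)
    (d i h x - d i f x) l (mem_set (bg x Kx)) (mem_set (bh x Kx)).
  suff <- : l%:num *: (d i g x - d i f x) + (1 - l%:num) *: (d i h x - d i f x) =
      d i (l%:num *: g + (1 - l%:num) *: h) x - d i f x by [].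
  rewrite dlin compact_open_initial_dZ !scalerBr addrACA -opprD -scalerDl.
  by rewrite [l%:num + _]addrC subrK scale1r.
Qed.

End compact_open_initial.

Section directional_derivatives.
Context (R : realType) (E : lmodType R) (F : lcsType R).
Implicit Types (f : E -> F) (x h : E).

Definition is_dirder f x h (l : F) :=
  (fun t : R => t^-1 *: (f (x + t *: h) - f x)) @ 0^' --> l.

Definition dirderivable f x h := exists l, is_dirder f x h l.

Definition dirder f h x : F := xget 0 [set l | is_dirder f x h l].

(* [iter_dirder f [:: y1; ..; yk]] is D_{yk} ... D_{y1} f. *)
Fixpoint iter_dirder f (ys : seq E) : E -> F :=
  if ys is y :: ys' then iter_dirder (dirder f y) ys' else f.

Fixpoint iter_dirderivable (O : set E) f (ys : seq E) : Prop :=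
  if ys is y :: ys' then
    (forall x, O x -> dirderivable f x y) /\
    iter_dirderivable O (dirder f y) ys'
  else True.

End directional_derivatives.

Section directional_derivatives_linear.
Context (R : realType) (E : topologicalLmodType R) (F : lcsType R).
Implicit Types (f g : E -> F) (O : set E).

Local Lemma is_dirder_unique f x h l1 l2 :
  is_dirder f x h l1 -> is_dirder f x h l2 -> l1 = l2.
Proof. exact: (cvg_unique (@hausdorff_spaceT R F)). Qed.

Local Lemma dirderP f x h : dirderivable f x h -> is_dirder f x h (dirder f h x).
Proof. by case=> l fl; rewrite /dirder; case: xgetP => // /(_ l). Qed.

Local Lemma is_dirder_dirder f x h l : is_dirder f x h l -> dirder f h x = l.
Proof.
by move=> fl; apply: is_dirder_unique (fl); apply: dirderP; exists l.
Qed.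

Local Lemma is_dirder_eq O f g x h l : open O -> {in O, f =1 g} -> O x ->
  is_dirder f x h l -> is_dirder g x h l.
Proof.
move=> oO fg Ox; apply: cvg_trans; apply: near_eq_cvg.
have nO : \forall t \near (0 : R^o), O (x + t *: h).
  have c : {for (0 : R^o), continuous (fun t : R^o => x + t *: h)}.
    apply: (@continuous_comp R^o (E * E)%type E (fun t => (x, t *: h))
      (fun q => q.1 + q.2)); last exact: add_continuous.
    apply: (@cvg_pair _ _ _ _ (nbhs x)); first exact: cvg_cst.
    apply: (@continuous_comp R^o (R^o * E)%type E (fun t => (t, h))
      (fun q => q.1 *: q.2)); last exact: scale_continuous.
    by apply: (@cvg_pair _ _ _ _ (nbhs (0 : R^o)) (nbhs h));
      [exact: cvg_id|exact: cvg_cst].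
  by apply: c; apply: open_nbhs_nbhs; split; rewrite // scale0r addr0.
near=> t; rewrite !fg ?inE //; near: t; exact: nbhs_dnbhs.
Unshelve. all: by end_near. Qed.

Local Lemma cvg_lin (T : Type) (G : set_system T) (u w : T -> F) (a : R) lu lw :
  Filter G -> u @ G --> lu -> w @ G --> lw ->
  (fun p => a *: u p + w p) @ G --> a *: lu + lw.
Proof.
move=> FG cu cw.
have cau : (fun p => a *: u p) @ G --> a *: lu.
  apply: (@cvg_comp _ _ _ (fun p => ((a : R^o), u p)) (fun q => q.1 *: q.2) G
    (nbhs ((a : R^o), lu))); last exact: (@scale_continuous R F (a, lu)).
  by apply: (@cvg_pair _ _ _ _ (nbhs (a : R^o))); first exact: cvg_cst.
apply: (@cvg_comp _ _ _ (fun p => (a *: u p, w p)) (fun q => q.1 + q.2) G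
  (nbhs (a *: lu, lw))); last exact: (@add_continuous F (a *: lu, lw)).
exact: cvg_pair.
Qed.

Local Lemma is_dirder_lin f g x h lf lg (a : R) :
  is_dirder f x h lf -> is_dirder g x h lg ->
  is_dirder (fun z => a *: f z + g z) x h (a *: lf + lg).
Proof.
move=> Hf Hg; rewrite /is_dirder.
rewrite (_ : (fun _ => _) = (fun t : R =>
  a *: (t^-1 *: (f (x + t *: h) - f x)) + t^-1 *: (g (x + t *: h) - g x))).
  exact: cvg_lin.
apply/funext => t.
by rewrite opprD addrACA -scalerBr scalerDr !scalerA [t^-1 * a]mulrC.
Qed.

Local Lemma iter_dirder_eq O f g ys : open O -> {in O, f =1 g} ->
  iter_dirderivable O f ys -> iter_dirderivable O g ys /\
  {in O, iter_dirder f ys =1 iter_dirder g ys}.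
Proof.
move=> oO; elim: ys f g => [|y ys IH] f g fg //= [fy fys].
have gE x : O x -> is_dirder g x y (dirder f y x).
  by move=> Ox; exact: (is_dirder_eq oO fg Ox (dirderP (fy _ Ox))).
have [gys fgE] : iter_dirderivable O (dirder g y) ys /\
    {in O, iter_dirder (dirder f y) ys =1 iter_dirder (dirder g y) ys}.
  apply: IH fys => x /set_mem Ox; apply/esym/is_dirder_dirder; exact: gE.
by split => //; split => // x Ox; exists (dirder f y x); exact: gE.
Qed.

Local Lemma iter_dirder_lin O f g ys (a : R) : open O ->
  iter_dirderivable O f ys -> iter_dirderivable O g ys ->
  iter_dirderivable O (fun z => a *: f z + g z) ys /\
  {in O, iter_dirder (fun z => a *: f z + g z) ys =1
         (fun z => a *: iter_dirder f ys z + iter_dirder g ys z)}.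
Proof.
move=> oO; elim: ys f g => [|y ys IH] f g //= [fy fys] [gy gys].
have hE x : O x -> is_dirder (fun z => a *: f z + g z) x y
    (a *: dirder f y x + dirder g y x).
  by move=> Ox; apply: is_dirder_lin; apply: dirderP; [exact: fy|exact: gy].
have [hys hysE] := IH _ _ fys gys.
have [] := @iter_dirder_eq O (fun z => a *: dirder f y z + dirder g y z)
  (dirder (fun z => a *: f z + g z) y) ys oO _ hys.
  by move=> x /set_mem Ox; apply/esym/is_dirder_dirder; exact: hE.
move=> hys' hysE'; split.
  split => // x Ox; exists (a *: dirder f y x + dirder g y x); exact: hE.
by move=> x Ox; rewrite -hysE' // hysE.
Qed.

Local Lemma iter_dirder0 O ys :
  iter_dirderivable O (fun=> 0 : F) ys /\
  iter_dirder (fun=> 0 : F) ys = (fun _ : E => 0).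
Proof.
have D0 x y : is_dirder (fun _ : E => 0 : F) x y 0.
  rewrite /is_dirder (_ : (fun _ => _) = (fun=> 0)); first exact: cvg_cst.
  by apply/funext => t; rewrite subrr scaler0.
have DE y : dirder (fun _ : E => 0 : F) y = fun=> 0.
  by apply/funext => x; exact: is_dirder_dirder.
elim: ys => [//|y ys [IH1 IH2]] /=; rewrite DE; split => //; split => //.
by move=> x _; exists 0.
Qed.

Local Lemma continuous_lin (T : topologicalType) (u w : T -> F) (a : R) :
  continuous u -> continuous w -> continuous (fun p => a *: u p + w p).
Proof. by move=> cu cw x; apply: cvg_lin; [exact: cu|exact: cw]. Qed.

End directional_derivatives_linear.

Section smooth_linear.
Context (R : realType) (E : topologicalLmodType R) (F : lcsType R).
Context (D Y : topologicalType) (v : D -> E) (dirs : Y -> seq E) (O : set E).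
Context (base : Prop) (ext : (D -> F) -> E -> F).
Hypothesis oO : open O.
Hypothesis dense_O : forall x, closure [set x | O (v x)] x.
Hypothesis ext_lin : forall a f g,
  ext (a *: f + g) = fun x => a *: ext f x + ext g x.

Let open_part (h : E -> F) :=
  (forall y, iter_dirderivable O h (dirs y)) /\
  {within O `*` setT,
    continuous (fun p : E * Y => iter_dirder h (dirs p.2) p.1)}.

Let extension f (g : D * Y -> F) :=
  [/\ continuous g,
      forall x y, O (v x) -> g (x, y) = iter_dirder (ext f) (dirs y) (v x) &
      base -> forall x y, g (x, y) = f x].

Local Lemma open_part_lin a f g : open_part (ext f) -> open_part (ext g) ->
  open_part (ext (a *: f + g)).
Proof.
move=> [Df cf] [Dg cg]; rewrite ext_lin; split => [y|].
  by have [] := iter_dirder_lin a oO (Df y) (Dg y).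
have := @continuous_lin _ _ (subspace (O `*` setT)) _ _ a cf cg.
apply: subspace_eq_continuous => -[x y] /set_mem [Ox _].
have [_ linE] := iter_dirder_lin a oO (Df y) (Dg y).
exact/esym/(linE x)/mem_set.
Qed.

Local Lemma extension_lin a f g f' g' : open_part (ext f) -> open_part (ext g) ->
  extension f f' -> extension g g' ->
  extension (a *: f + g) (fun p => a *: f' p + g' p).
Proof.
move=> [Df _] [Dg _] [cf fE f0] [cg gE g0]; split.
- exact: continuous_lin.
- move=> x y Ox; rewrite fE // gE // ext_lin.
  have [_ linE] := iter_dirder_lin a oO (Df y) (Dg y).
  exact/esym/(linE (v x))/mem_set.
- by move=> b x y; rewrite f0 // g0.
Qed.

Local Lemma open_part0 : ext 0 = (fun=> 0) -> open_part (ext 0).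
Proof.
move=> ->; split => [y|]; first by have [] := @iter_dirder0 R E F O (dirs y).
rewrite (_ : (fun p => _) = (fun=> 0)); first by move=> p; exact: cvg_cst.
by apply/funext => p; have [_ ->] := @iter_dirder0 R E F O (dirs p.2).
Qed.

Local Lemma extension0 : ext 0 = (fun=> 0) -> extension 0 (fun=> 0).
Proof.
move=> ext0; split => //; first by move=> p; exact: cvg_cst.
by move=> x y _; have [_] := @iter_dirder0 R E F O (dirs y); rewrite ext0 => ->.
Qed.

Local Lemma extension_unique f g1 g2 :
  extension f g1 -> extension f g2 -> g1 = g2.
Proof.
move=> [c1 E1 _] [c2 E2 _]; apply/funext => -[x y].
apply: (@hausdorff_spaceT R F) => A B nA nB.
have [[P Q] /= [nP nQ] PQ] : nbhs (x, y) (g1 @^-1` A `&` g2 @^-1` B).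
  by apply: filterI; [exact: c1|exact: c2].
have [x' [Ox' Px']] := dense_O nP.
have [A1 B2] := PQ (x', y) (conj Px' (nbhs_singleton nQ)).
by exists (g1 (x', y)); split => //; rewrite E1 // -E2.
Qed.

End smooth_linear.

(* Locally convex subsets with dense interior; neighbourhoods in the subset are
   those of its subspace topology. *)
Record lcSubset (R : realType) (E : lcsType R) := LcSubset {
  lc_set :> set E;
  lc_set_locally_convex : forall x, lc_set x ->
    exists C : set E,
      [/\ convex_set C, C `<=` lc_set & within lc_set (nbhs x) C];
  lc_set_dense_interior : lc_set `<=` closure lc_set° }.

(* Smoothness orders in N u {oo} are represented in [option nat], [None]
   standing for oo. *)
Definition leq_oo (k : nat) (r : option nat) : bool :=
  if r is Some n then (k <= n)%N else true.

Section Cr.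
Context (R : realType) (E F : lcsType R).

(* d^(k) f (x, y_1, .., y_k) = (D_{y_k} ... D_{y_1} f)(x), with E^k rendered as
   the topological product {ptws 'I_k -> E}. *)
Definition iter_diff k (f : E -> F) (p : E * {ptws 'I_k -> E}) : F :=
  iter_dirder f [seq p.2 i | i <- enum 'I_k] p.1.

Definition open_Cr (O : set E) (r : option nat) (f : E -> F) :=
  forall k, leq_oo k r ->
    (forall y : 'I_k -> E, iter_dirderivable O f [seq y i | i <- enum 'I_k]) /\
    {within O `*` setT, continuous (@iter_diff k f)}.

Context (U : lcSubset E).

(* The values of [zero_ext f] outside U are irrelevant: only derivatives at
   interior points of U are considered. *)
Definition zero_ext (f : U -> F) : E -> F := 'valL_0 f.

(* g is a continuous extension of d^(k) (f restricted to U°), with d^(0) f = f.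
   Since U° is dense in U and F is Hausdorff, there is at most one such g. *)
Definition diffk_extension k (f : U -> F) (g : U * {ptws 'I_k -> E} -> F) :=
  [/\ continuous g,
      forall x y, U° (\val x) -> g (x, y) = iter_diff (zero_ext f) (\val x, y) &
      k = 0%N -> forall x y, g (x, y) = f x].

Definition Cr_map (r : option nat) (f : U -> F) :=
  open_Cr U° r (zero_ext f) /\
  forall k, leq_oo k r -> exists g, @diffk_extension k f g.

(* The map d^(k) f : U x E^k -> F, when f is C^r with k <= r. *)
Definition diffk k (f : U -> F) : U * {ptws 'I_k -> E} -> F :=
  xget (fun=> 0) [set g | diffk_extension f g].

Section Cr_linear.
Variable r : option nat.

Local Lemma zero_ext_lin a (f g : U -> F) :
  zero_ext (a *: f + g) = fun x => a *: zero_ext f x + zero_ext g x.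
Proof.
apply/funext => x; rewrite /zero_ext /valL_ /=.
by case: ('oinv_ _ x) => //=; rewrite scaler0 addr0.
Qed.

Local Lemma zero_ext0 : zero_ext 0 = fun=> 0.
Proof.
by apply/funext => x; rewrite /zero_ext /valL_ /=; case: ('oinv_ _ x).
Qed.

Local Lemma closure_interior_val (x : U) : closure [set x : U | U° (\val x)] x.
Proof.
move=> B [_ [[W oW <-] Wx] WB].
have Ux : lc_set U (\val x) by exact: set_valP.
have [z [Uz Wz]] := lc_set_dense_interior Ux (open_nbhs_nbhs (conj oW Wx)).
by exists (exist _ z (mem_set (interior_subset Uz))); split => //; exact: WB.
Qed.

Let dirs k (y : {ptws 'I_k -> E}) := [seq y i | i <- enum 'I_k].

Local Lemma diffk_extension_lin k a f g f' g' :
  leq_oo k r -> Cr_map r f -> Cr_map r g ->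
  @diffk_extension k f f' -> @diffk_extension k g g' ->
  @diffk_extension k (a *: f + g) (fun p => a *: f' p + g' p).
Proof.
move=> kr [of_ _] [og _].
exact: (@extension_lin R E F U _ (fun x : U => \val x) (@dirs k) _ _ _
  (@open_interior _ U) zero_ext_lin a f g f' g' (of_ k kr) (og k kr)).
Qed.

Local Lemma Cr_map_submod_closed : submod_closed (mem [set f | Cr_map r f]).
Proof.
split=> [|a f g].
  rewrite inE; split => k kr.
    exact: (@open_part0 R E F U _ (@dirs k) _ _ zero_ext0).
  exists (fun=> 0).
  exact: (@extension0 R E F U _ (fun x : U => \val x) (@dirs k) _ _ _ zero_ext0).
rewrite !inE => Hf Hg; have [[of_ ef] [og eg]] := (Hf, Hg); split => k kr.
  exact: (@open_part_lin R E F _ _ (@dirs k) _ _ (@open_interior _ U)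
    zero_ext_lin a f g (of_ k kr) (og k kr)).
have [f' ff'] := ef k kr; have [g' gg'] := eg k kr.
by exists (fun p => a *: f' p + g' p); exact: diffk_extension_lin.
Qed.

Local Lemma diffP k f : leq_oo k r -> Cr_map r f -> diffk_extension f (@diffk k f).
Proof.
by move=> kr [_ /(_ k kr) [g fg]]; rewrite /diffk; case: xgetP => // /(_ g).
Qed.

Local Lemma diff_unique k f g : leq_oo k r -> Cr_map r f ->
  diffk_extension f g -> @diffk k f = g.
Proof.
move=> kr Hf; have := diffP kr Hf.
exact: (@extension_unique R E F U _ (fun x : U => \val x) (@dirs k) _ _ _
  closure_interior_val).
Qed.

End Cr_linear.
End Cr.

Section CrSpace.
Context (R : realType) (E : lcsType R) (U : lcSubset E) (r : option nat).
Context (F : lcsType R).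

Definition Cr_pred : {pred U -> F} := mem [set f : U -> F | Cr_map r f].

(* The space C^r(U, F). *)
Record CrSpace := MkCrSpace { Cr_fun :> U -> F; _ : Cr_fun \in Cr_pred }.

HB.instance Definition _ := [isSub for Cr_fun].
HB.instance Definition _ := [Choice of CrSpace by <:].
HB.instance Definition _ := GRing.isSubmodClosed.Build _ _ Cr_pred
  (@Cr_map_submod_closed R E F U r).
HB.instance Definition _ := [SubChoice_isSubLmodule of CrSpace by <:].

Definition Cr_diff (k : {k : nat | leq_oo k r}) (f : CrSpace) :
  U * {ptws 'I_(val k) -> E} -> F := @diffk R E F U (val k) f.
Local Arguments Cr_diff : clear implicits.

HB.instance Definition _ := Topological.copy CrSpace (compact_open_initial Cr_diff).

Local Lemma Cr_mapP (f : CrSpace) : Cr_map r f.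
Proof. by case: f => f /= /set_mem. Qed.

Local Lemma Cr_diff_lin k a f g x :
  Cr_diff k (a *: f + g) x = a *: Cr_diff k f x + Cr_diff k g x.
Proof.
have [[kr Hf] Hg] := (valP k, Cr_mapP f, Cr_mapP g).
have := diffk_extension_lin a kr Hf Hg (diffP kr Hf) (diffP kr Hg).
move=> /(diff_unique kr (Cr_mapP (a *: f + g))) /(congr1 (@^~ x)); exact.
Qed.

Local Lemma Cr_diff_continuous k f : continuous (Cr_diff k f).
Proof. by have [] := diffP (valP k) (Cr_mapP f). Qed.

Local Lemma Cr_diff_sep f g : (forall k x, Cr_diff k f x = Cr_diff k g x) ->
  f = g.
Proof.
have r0 : leq_oo 0 r by case: r.
move=> fg; apply/val_inj/funext => x; rewrite /=.
have [_ _ /(_ erefl x (fun=> 0)) <-] := diffP r0 (Cr_mapP f).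
have [_ _ /(_ erefl x (fun=> 0)) <-] := diffP r0 (Cr_mapP g).
exact: (fg (exist _ 0%N r0)).
Qed.

(* This factory only provides the uniform structure. *)
HB.instance Definition _ := PreTopologicalLmod_isTvs.Build R CrSpace
  (compact_open_initial_add Cr_diff_lin Cr_diff_continuous)
  (compact_open_initial_scale Cr_diff_lin Cr_diff_continuous)
  (compact_open_initial_convex Cr_diff_lin Cr_diff_continuous).
HB.instance Definition _ :=
  PreTopologicalNmodule_isTopologicalNmodule.Build CrSpace
  (compact_open_initial_add Cr_diff_lin Cr_diff_continuous).
HB.instance Definition _ :=
  TopologicalNmodule_isTopologicalLmodule.Build R CrSpace
  (compact_open_initial_scale Cr_diff_lin Cr_diff_continuous).
HB.instance Definition _ := Uniform_isTvs.Build R CrSpace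
  (compact_open_initial_convex Cr_diff_lin Cr_diff_continuous).
HB.instance Definition _ := Topological_isHausdorff.Build CrSpace
  (compact_open_initial_hausdorff Cr_diff_continuous Cr_diff_sep).

End CrSpace.

Section Crs.
Context (R : realType) (E1 E2 F : lcsType R).

(* d^(i,j) f (x, y, w_1, .., w_i, v_1, .., v_j) =
   (D_{(w_i,0)} ... D_{(w_1,0)} D_{(0,v_j)} ... D_{(0,v_1)} f)(x, y):
   the derivatives in the second variable are taken first. *)
Definition iter_diff2 i j (f : E1 * E2 -> F)
    (p : (E1 * E2) * ({ptws 'I_i -> E1} * {ptws 'I_j -> E2})) : F :=
  iter_dirder f ([seq (0, p.2.2 b) | b <- enum 'I_j] ++
                 [seq (p.2.1 a, 0) | a <- enum 'I_i]) p.1.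

Definition open_Crs (O1 : set E1) (O2 : set E2) (r s : option nat)
    (f : E1 * E2 -> F) :=
  forall i j, leq_oo i r -> leq_oo j s ->
    (forall (w : 'I_i -> E1) (v : 'I_j -> E2),
       iter_dirderivable (O1 `*` O2) f
         ([seq (0, v b) | b <- enum 'I_j] ++ [seq (w a, 0) | a <- enum 'I_i])) /\
    {within (O1 `*` O2) `*` setT, continuous (@iter_diff2 i j f)}.

Context (U : lcSubset E1) (V : lcSubset E2).

Definition zero_ext2 (f : U * V -> F) : E1 * E2 -> F :=
  fun p => zero_ext (fun x : U => zero_ext (fun y : V => f (x, y)) p.2) p.1.

Definition diffk2_extension i j (f : U * V -> F)
    (g : (U * V) * ({ptws 'I_i -> E1} * {ptws 'I_j -> E2}) -> F) :=
  [/\ continuous g,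
      forall x y wv, U° (\val x) -> V° (\val y) ->
        g ((x, y), wv) = iter_diff2 (zero_ext2 f) ((\val x, \val y), wv) &
      i = 0%N -> j = 0%N -> forall x y wv, g ((x, y), wv) = f (x, y)].

Definition Crs_map (r s : option nat) (f : U * V -> F) :=
  open_Crs U° V° r s (zero_ext2 f) /\
  forall i j, leq_oo i r -> leq_oo j s -> exists g, @diffk2_extension i j f g.

(* The map d^(i,j) f : U x V x E1^i x E2^j -> F, when f is C^{r,s} with
   i <= r and j <= s. *)
Definition diffk2 i j (f : U * V -> F) :
    (U * V) * ({ptws 'I_i -> E1} * {ptws 'I_j -> E2}) -> F :=
  xget (fun=> 0) [set g | diffk2_extension f g].

Section Crs_linear.
Variables (r s : option nat).

Let O : set (E1 * E2) := U° `*` V°.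
Let vals (q : U * V) : E1 * E2 := (\val q.1, \val q.2).
Let dirs i j (wv : {ptws 'I_i -> E1} * {ptws 'I_j -> E2}) : seq (E1 * E2) :=
  [seq (0, wv.2 b) | b <- enum 'I_j] ++ [seq (wv.1 a, 0) | a <- enum 'I_i].

Local Lemma open_O : open O.
Proof.
rewrite openE => -[x y] [Ux Vy]; exists (U°, V°) => //=.
by split; apply: open_nbhs_nbhs; split => //; exact: open_interior.
Qed.

Local Lemma zero_ext2_lin a (f g : U * V -> F) :
  zero_ext2 (a *: f + g) = fun x => a *: zero_ext2 f x + zero_ext2 g x.
Proof.
apply/funext => p; rewrite /zero_ext2.
rewrite -[RHS]/((fun q => a *: zero_ext _ q + zero_ext _ q) p.1) -zero_ext_lin.
congr (zero_ext _ _); apply/funext => x.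
rewrite -[RHS]/((fun q => a *: zero_ext _ q + zero_ext _ q) p.2) -zero_ext_lin.
by [].
Qed.

Local Lemma zero_ext20 : zero_ext2 0 = fun=> 0.
Proof.
apply/funext => p; rewrite /zero_ext2.
rewrite (_ : (fun x => _) = 0); first by rewrite zero_ext0.
apply/funext => x; rewrite (_ : (fun y => _) = 0)//.
by rewrite zero_ext0.
Qed.

Local Lemma closure_interior_vals (q : U * V) : closure [set q : U * V | O (vals q)] q.
Proof.
case: q => x y B [[P Q] /= [nP nQ] PQ].
have [x' [Ux' Px']] := closure_interior_val nP.
have [y' [Vy' Qy']] := closure_interior_val nQ.
by exists (x', y'); split => //; exact: PQ.
Qed.

Local Lemma diffk2_extensionE i j f g : @diffk2_extension i j f g <->
  [/\ continuous g,
      forall q y, O (vals q) -> g (q, y) =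
        iter_dirder (zero_ext2 f) (@dirs i j y) (vals q) &
      (i = 0%N /\ j = 0%N) -> forall q y, g (q, y) = f q].
Proof.
split=> -[cg gE g0]; split => //.
- by move=> [x y] wv [Ux Vy]; exact: gE.
- by move=> [i0 j0] [x y] wv; exact: g0.
- by move=> x y wv Ux Vy; exact: (gE (x, y)).
- by move=> i0 j0 x y wv; exact: g0.
Qed.

Local Lemma open_CrsE f : open_Crs U° V° r s f <->
  forall i j, leq_oo i r -> leq_oo j s ->
    (forall wv, iter_dirderivable O f (@dirs i j wv)) /\
    {within O `*` setT, continuous (fun p => iter_dirder f (@dirs i j p.2) p.1)}.
Proof.
split=> H i j ir js; have [Hd Hc] := H i j ir js; split => //.
  by move=> [w v]; exact: Hd.
by move=> w v; exact: (Hd (w, v)).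
Qed.

Local Lemma diffk2_extension_lin i j a f g f' g' :
  leq_oo i r -> leq_oo j s -> Crs_map r s f -> Crs_map r s g ->
  @diffk2_extension i j f f' -> @diffk2_extension i j g g' ->
  @diffk2_extension i j (a *: f + g) (fun p => a *: f' p + g' p).
Proof.
move=> ir js [/open_CrsE of_ _] [/open_CrsE og _].
move=> /diffk2_extensionE Hf /diffk2_extensionE Hg; apply/diffk2_extensionE.
exact: (@extension_lin R _ F _ _ vals (@dirs i j) _ _ _
  open_O zero_ext2_lin a f g f' g' (of_ i j ir js) (og i j ir js) Hf Hg).
Qed.

Local Lemma Crs_map_submod_closed : submod_closed (mem [set f | Crs_map r s f]).
Proof.
split=> [|a f g].
  rewrite inE; split.
    apply/open_CrsE => i j ir js.
    exact: (@open_part0 R _ F (U * V)%type _ (@dirs i j) _ _ zero_ext20).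
  move=> i j ir js; exists (fun=> 0); apply/diffk2_extensionE.
  exact: (@extension0 R _ F _ _ vals (@dirs i j) _ _ _ zero_ext20).
rewrite !inE => Hf Hg; have [[of_ ef] [og eg]] := (Hf, Hg); split.
  move/open_CrsE : of_ => of_; move/open_CrsE : og => og.
  apply/open_CrsE => i j ir js.
  exact: (@open_part_lin R _ F _ _ (@dirs i j) _ _ open_O
    zero_ext2_lin a f g (of_ i j ir js) (og i j ir js)).
move=> i j ir js; have [f' ff'] := ef i j ir js; have [g' gg'] := eg i j ir js.
by exists (fun p => a *: f' p + g' p); exact: diffk2_extension_lin.
Qed.

Local Lemma diffk2P i j f : leq_oo i r -> leq_oo j s -> Crs_map r s f ->
  diffk2_extension f (@diffk2 i j f).
Proof.
move=> ir js [_ /(_ i j ir js) [g fg]].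
by rewrite /diffk2; case: xgetP => // /(_ g).
Qed.

Local Lemma diffk2_unique i j f g : leq_oo i r -> leq_oo j s ->
  Crs_map r s f -> diffk2_extension f g -> @diffk2 i j f = g.
Proof.
move=> ir js Hf; have /diffk2_extensionE := diffk2P ir js Hf.
move=> H /diffk2_extensionE; move: H.
exact: (@extension_unique R _ F _ _ vals (@dirs i j) _ _ _
  closure_interior_vals).
Qed.

End Crs_linear.
End Crs.

Section CrsSpace.
Context (R : realType) (E1 E2 : lcsType R) (U : lcSubset E1) (V : lcSubset E2).
Context (r s : option nat) (F : lcsType R).

Definition Crs_pred : {pred U * V -> F} :=
  mem [set f : U * V -> F | Crs_map r s f].

(* The space C^{r,s}(U x V, F). *)
Record CrsSpace := MkCrsSpace { Crs_fun :> U * V -> F; _ : Crs_fun \in Crs_pred }.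

HB.instance Definition _ := [isSub for Crs_fun].
HB.instance Definition _ := [Choice of CrsSpace by <:].
HB.instance Definition _ := GRing.isSubmodClosed.Build _ _ Crs_pred
  (@Crs_map_submod_closed R E1 E2 F U V r s).
HB.instance Definition _ := [SubChoice_isSubLmodule of CrsSpace by <:].

Definition Crs_diff (ij : {i : nat | leq_oo i r} * {j : nat | leq_oo j s})
    (f : CrsSpace) :=
  @diffk2 R E1 E2 F U V (val ij.1) (val ij.2) f.
Local Arguments Crs_diff : clear implicits.

HB.instance Definition _ :=
  Topological.copy CrsSpace (compact_open_initial Crs_diff).

Local Lemma Crs_mapP (f : CrsSpace) : Crs_map r s f.
Proof. by case: f => f /= /set_mem. Qed.

Local Lemma Crs_diff_lin ij a f g x :
  Crs_diff ij (a *: f + g) x = a *: Crs_diff ij f x + Crs_diff ij g x.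
Proof.
have [[ir js] [Hf Hg]] := ((valP ij.1, valP ij.2), (Crs_mapP f, Crs_mapP g)).
have := diffk2_extension_lin a ir js Hf Hg
  (diffk2P ir js Hf) (diffk2P ir js Hg).
move=> /(diffk2_unique ir js (Crs_mapP (a *: f + g))) /(congr1 (@^~ x)).
exact.
Qed.

Local Lemma Crs_diff_continuous ij f : continuous (Crs_diff ij f).
Proof. by have [] := diffk2P (valP ij.1) (valP ij.2) (Crs_mapP f). Qed.

Local Lemma Crs_diff_sep f g :
  (forall ij x, Crs_diff ij f x = Crs_diff ij g x) -> f = g.
Proof.
have [r0 s0] : leq_oo 0 r /\ leq_oo 0 s by case: r s => [?|] [?|].
pose wv : {ptws 'I_0 -> E1} * {ptws 'I_0 -> E2} := (fun=> 0, fun=> 0).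
move=> fg; apply/val_inj/funext => -[x y]; rewrite /=.
have [_ _ /(_ erefl erefl x y wv) <-] := diffk2P r0 s0 (Crs_mapP f).
have [_ _ /(_ erefl erefl x y wv) <-] := diffk2P r0 s0 (Crs_mapP g).
exact: (fg (exist _ 0%N r0, exist _ 0%N s0)).
Qed.

HB.instance Definition _ := PreTopologicalLmod_isTvs.Build R CrsSpace
  (compact_open_initial_add Crs_diff_lin Crs_diff_continuous)
  (compact_open_initial_scale Crs_diff_lin Crs_diff_continuous)
  (compact_open_initial_convex Crs_diff_lin Crs_diff_continuous).
HB.instance Definition _ :=
  PreTopologicalNmodule_isTopologicalNmodule.Build CrsSpace
  (compact_open_initial_add Crs_diff_lin Crs_diff_continuous).
HB.instance Definition _ :=
  TopologicalNmodule_isTopologicalLmodule.Build R CrsSpace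
  (compact_open_initial_scale Crs_diff_lin Crs_diff_continuous).
HB.instance Definition _ := Uniform_isTvs.Build R CrsSpace
  (compact_open_initial_convex Crs_diff_lin Crs_diff_continuous).
HB.instance Definition _ := Topological_isHausdorff.Build CrsSpace
  (compact_open_initial_hausdorff Crs_diff_continuous Crs_diff_sep).

End CrsSpace.

(* The second clause says that the topology is final with respect to the
   inclusions of the compact subsets. *)
Definition k_space (X : topologicalType) :=
  hausdorff_space X /\
  forall A : set X,
    open A <-> forall K : set X, compact K -> open (@set_val _ K @^-1` A).

(* Homeomorphism onto the image. *)
Definition topological_embedding (X Y : topologicalType) (f : X -> Y) :=
  [/\ injective f, continuous f &
      forall A, open A -> exists2 B, open B & f @` A = range f `&` B].

Definition tvs_isomorphism (R : realType) (X Y : lcsType R)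
    (f : {linear X -> Y}) :=
  exists g : Y -> X, [/\ cancel f g, cancel g f, continuous f & continuous g].

(* Main.v *)
Require Import Defs.
From HB Require Import structures.
From mathcomp Require Import all_boot all_order all_algebra.
From mathcomp Require Import all_classical all_reals all_analysis.
From mathcomp Require Import ring.

(** The exponential law is proved by handling all derivatives of a map at once. A
    [jet] of a map f on U is a family [D x ys], indexed by sequences ys of
    directions, that starts with f, is continuous on U for each length of ys,
    and is such that, in the interior of U, [D^~ (rcons ys h)] is the derivative
    of [D^~ ys] in direction h. Being C^r amounts to having a jet of order r
    ([jet_Cr_map], [diff_jetP]); its values are unique up to order r, as the
    interior is dense;
    [jet2] does the same for C^(r,s)-maps. What has to be shown is that the same
    values [D x y ws vs] form the jet of f and, regrouped, the jet of the curried
    map.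

    The analytic input is a mean value estimate ([mean_value_convex]), which holds
    in every locally convex space. It implies that difference quotients converge
    locally uniformly in parameters ([quotient_cvg]), whence differentiation can
    be exchanged with limits ([is_dirder_limit]) and with another differentiation
    ([is_dirder_exchange]).

    Let D be the jet of a C^(r,s)-map f. For fixed x and ws, the values
    [D x y ws vs] form a jet in y: for interior x by exchanging derivatives
    ([jet2_interior_dirder2]), for the other x by passing to the limit
    ([jet2_dirder2_boundary]). This is an element of C^s(V, F) depending on
    (x, ws). Convergence in C^s(V, F) being uniform convergence of the derivatives
    on compact sets, the uniformity of difference quotients on compact sets of
    parameters ([near_compact_quotient]) shows that these elements form the jet of
    the curried map ([curry_jetP]). Currying is an embedding because the two
    topologies express uniform convergence of the same functions, once on compact
    sets and once on products of compact sets ([exponential_cvgP]).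

    Conversely, a C^r-map eta with values in C^s(V, F) yields values
    [uncurry_jet], evaluations of derivatives of derivatives. They are derivatives
    of the uncurried map because evaluation is linear and continuous; only their
    joint continuity needs the extra hypothesis. If V is locally compact, then so
    is E2 whenever V has a point, and evaluation is jointly continuous on a locally
    compact space. If U x V x E1 x E2 is a k-space, joint continuity has to be
    tested on compact sets only, where evaluation is again continuous; this
    covers equal directions in each factor, to which the general case reduces by
    polarization ([continuous_polarization]), since higher derivatives are
    symmetric ([jet_perm]) and multilinear ([jet_linear]). *)

Set Implicit Arguments.
Unset Strict Implicit.
Unset Printing Implicit Defensive.

Import Order.TTheory GRing.Theory Num.Theory.
Import numFieldTopology.Exports.
Local Open Scope classical_set_scope.
Local Open Scope ring_scope.

(** * Limits in locally convex spaces *)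

Section real_nbhs.
Context (R : realType).

Lemma near0P (P : set R) : (\forall t \near (0 : R), P t) <->
  exists2 e, 0 < e & forall t, `|t| < e -> P t.
Proof.
split.
  move/nbhs_ballP => [e e0 eP]; exists e => // t te; apply: eP.
  by rewrite /ball /= sub0r normrN.
move=> [e e0 eP]; apply/nbhs_ballP; exists e => // t.
by rewrite /ball /= sub0r normrN; exact: eP.
Qed.

Lemma dnear0P (P : set R) : (\forall t \near 0^', P t) <->
  exists2 e, 0 < e & forall t, t != 0 -> `|t| < e -> P t.
Proof.
split.
  by move=> /near0P [e e0 eP]; exists e => // t t0 te; exact: eP.
by move=> [e e0 eP]; apply/near0P; exists e => // t te t0; exact: eP.
Qed.

End real_nbhs.

Lemma cvg_to_pair (T : Type) (X Y : topologicalType) (G : set_system T)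
    (u : T -> X) (w : T -> Y) (a : X) (b : Y) {FG : Filter G} :
  u @ G --> a -> w @ G --> b -> (fun t => (u t, w t)) @ G --> (a, b).
Proof. by move=> ua wb; apply: (@cvg_pair _ _ _ _ (nbhs a) (nbhs b)). Qed.

Lemma continuous_at_pair (T X Y : topologicalType) (u : T -> X) (w : T -> Y) t :
  {for t, continuous u} -> {for t, continuous w} ->
  {for t, continuous (fun z => (u z, w z))}.
Proof. by move=> cu cw; exact: cvg_to_pair. Qed.

Lemma continuous_compose (X Y Z : topologicalType) (e : X -> Y) (g : Y -> Z) :
  continuous g -> continuous e -> continuous (fun x => g (e x)).
Proof. by move=> cg ce x; apply: continuous_comp; [exact: ce|exact: cg]. Qed.

Lemma continuous_pair (T X Y : topologicalType) (u : T -> X) (w : T -> Y) :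
  continuous u -> continuous w -> continuous (fun z => (u z, w z)).
Proof. by move=> cu cw t; apply: continuous_at_pair; [exact: cu|exact: cw]. Qed.

Lemma continuous_fst (X Y : topologicalType) : continuous (@fst X Y).
Proof. by move=> p; exact: cvg_fst. Qed.

Lemma continuous_snd (X Y : topologicalType) : continuous (@snd X Y).
Proof. by move=> p; exact: cvg_snd. Qed.

Section limits.
Context (R : realType) (F : lcsType R).

Lemma lcs_cvgD (T : Type) (G : set_system T) (u w : T -> F) a b {FG : Filter G} :
  u @ G --> a -> w @ G --> b -> (fun t => u t + w t) @ G --> a + b.
Proof.
move=> ua wb.
rewrite -[a]scale1r (_ : (fun t => _) = fun t => 1 *: u t + w t).
  exact: Defs.cvg_lin.
by apply/funext => t; rewrite scale1r.
Qed.

Lemma lcs_cvgZ (T : Type) (G : set_system T) (u : T -> F) (a : R) b {FG : Filter G} :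
  u @ G --> b -> (fun t => a *: u t) @ G --> a *: b.
Proof.
move=> ub; rewrite -[a *: b]addr0.
rewrite (_ : (fun t => _) = fun t => a *: u t + 0).
  by apply: Defs.cvg_lin => //; exact: cvg_cst.
by apply/funext => t; rewrite addr0.
Qed.

Lemma lcs_cvgB (T : Type) (G : set_system T) (u w : T -> F) a b {FG : Filter G} :
  u @ G --> a -> w @ G --> b -> (fun t => u t - w t) @ G --> a - b.
Proof.
move=> ua wb; rewrite -scaleN1r.
rewrite (_ : (fun t => _) = fun t => u t + -1 *: w t).
  by apply: lcs_cvgD => //; exact: lcs_cvgZ.
by apply/funext => t; rewrite scaleN1r.
Qed.

Lemma lcs_continuousD (T : topologicalType) (u w : T -> F) :
  continuous u -> continuous w -> continuous (fun t => u t + w t).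
Proof. by move=> cu cw t; apply: lcs_cvgD; [exact: cu|exact: cw]. Qed.

Lemma lcs_continuousZ (T : topologicalType) (u : T -> F) (a : R) :
  continuous u -> continuous (fun t => a *: u t).
Proof. by move=> cu t; apply: lcs_cvgZ; exact: cu. Qed.

Lemma lcs_continuousB (T : topologicalType) (u w : T -> F) :
  continuous u -> continuous w -> continuous (fun t => u t - w t).
Proof. by move=> cu cw t; apply: lcs_cvgB; [exact: cu|exact: cw]. Qed.

Lemma lcs_cvg_line (x h : F) : (fun t : R => x + t *: h) @ (0 : R) --> x.
Proof.
rewrite -[X in _ --> X]addr0 -[X in _ + X](scale0r h).
apply: lcs_cvgD; first exact: cvg_cst.
apply: (@cvg_comp _ _ _ (fun t : R => (t : R^o, h)) (fun q => q.1 *: q.2)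
  _ (nbhs ((0 : R^o), h))); last exact: (@scale_continuous R F (0, h)).
by apply: (@cvg_pair _ _ _ _ (nbhs (0 : R^o)) (nbhs h)); [exact: cvg_id|exact: cvg_cst].
Qed.

Lemma cvg_line2 (x a b : F) :
  (fun p : R * R => x + p.1 *: a + p.2 *: b) @ ((0 : R), (0 : R)) --> x.
Proof.
rewrite -[X in _ --> X]addr0 -[X in _ + X](scale0r b).
apply: lcs_cvgD.
  apply: (cvg_comp _ (fun t : R => x + t *: a) cvg_fst); exact: lcs_cvg_line.
have : (fun t : R => 0 + t *: b) @ (0 : R) --> (0 : F) by exact: lcs_cvg_line.
rewrite scale0r => H.
apply: (cvg_comp _ (fun t : R => t *: b) cvg_snd).
by under eq_fun do rewrite -[_ *: b]add0r.
Qed.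

Lemma near_line2 (x a b : F) (P : set F) : nbhs x P ->
  \forall s \near (0 : R) & t \near (0 : R), P (x + s *: a + t *: b).
Proof. by move/(@cvg_line2 x a b). Qed.

Definition segment_convex (C : set F) := forall x y (a : R),
  C x -> C y -> 0 <= a -> a <= 1 -> C (a *: x + (1 - a) *: y).

Lemma nbhs_convex (l : F) (A : set F) : nbhs l A ->
  exists C : set F, [/\ open C, C l, C `<=` A & segment_convex C].
Proof.
move=> nA; have [Bs Bs_convex [Bs_open Bs_basis]] := @locally_convex R F.
have [C [BsC Cl] CA] := Bs_basis l A nA.
exists C; split=> //; first exact: Bs_open.
move=> x y a Cx Cy a0 a1.
exact/set_mem/(Bs_convex _ (mem_set BsC) x y (Itv01 a0 a1) (mem_set Cx) (mem_set Cy)).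
Qed.

(** Topological vector spaces are regular: limits of points of [B] stay in [A]. *)
Lemma nbhs_closure (l : F) (A : set F) : nbhs l A ->
  exists2 B, nbhs l B & closure B `<=` A.
Proof. by move=> nA; apply: uniform_regular. Qed.

End limits.

(** * Mean value estimate and limits of directional derivatives *)

Section mean_value.
Context (R : realType) (E : lmodType R) (F : lcsType R).

(** Call an interval [[a, b]] good if the difference quotient of f over it lies
    in C. Since C is open, all short intervals with a given endpoint are good;
    since C is convex, adjacent good intervals merge into a good one, the
    quotient of the union being a convex combination of the two quotients. The
    supremum of the s for which [[0, s]] is good is therefore attained and equal
    to 1. *)
Lemma mean_value_convex (f : E -> F) x h (C : set F) :
  open C -> segment_convex C ->
  (forall s : R, 0 <= s -> s <= 1 -> exists2 l, C l & is_dirder f (x + s *: h) h l) ->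
  C (f (x + h) - f x).
Proof.
move=> oC cC der.
pose g s := f (x + s *: h).
pose Q (a b : R) := C ((b - a)^-1 *: (g b - g a)).
have Qsym a b : Q a b -> Q b a.
  by rewrite /Q -opprB -(opprB (g a)) scalerN invrN scaleNr opprK.
have Qtrans a b c : a < b -> b < c -> Q a b -> Q b c -> Q a c.
  move=> ab bc Qab Qbc.
  have ac : 0 < c - a by rewrite subr_gt0 (lt_trans ab).
  have ba : 0 < b - a by rewrite subr_gt0.
  have cb : 0 < c - b by rewrite subr_gt0.
  have := cC _ _ ((b - a) / (c - a)) Qab Qbc.
  have w0 : 0 <= (b - a) / (c - a) by rewrite divr_ge0 ?(ltW ba) ?(ltW ac).
  have w1 : (b - a) / (c - a) <= 1.
    by rewrite ler_pdivrMr// mul1r lerD2r (ltW bc).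
  move=> /(_ w0 w1).
  have -> : 1 - (b - a) / (c - a) = (c - b) / (c - a).
    by field; rewrite gt_eqF.
  rewrite !scalerA mulrAC divff ?gt_eqF// mul1r mulrAC divff ?gt_eqF// mul1r.
  by rewrite -scalerDr [X in C (_ *: X)]addrC addrA subrK.
have loc s : 0 <= s -> s <= 1 ->
    exists2 d, 0 < d & forall u, u != s -> `|u - s| < d -> Q s u.
  move=> s0 s1; have [l Cl fl] := der s s0 s1.
  have /dnear0P[d d0 Pd] : \forall t \near 0^',
      C (t^-1 *: (f (x + s *: h + t *: h) - f (x + s *: h))).
    by apply: fl; exact: open_nbhs_nbhs.
  exists d => // u us usd; have := Pd (u - s).
  by rewrite subr_eq0 -addrA -scalerDl [s + _]addrC subrK; exact.
pose S : set R := [set s | [/\ 0 <= s, s <= 1 & s = 0 \/ Q 0 s]].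
have S0 : S 0 by split => //; left.
have hS : has_sup S by split; [exists 0|exists 1 => s []].
set tau := sup S.
have tau0 : 0 <= tau by apply: sup_upper_bound.
have tau1 : tau <= 1 by apply: ge_sup; [exists 0|move=> s []].
have [d d0 Hd] := loc tau tau0 tau1.
have Stau : S tau.
  have [s Ss taus] := sup_adherent d0 hS.
  have stau : s <= tau by exact: sup_upper_bound.
  have [<-//|s_tau] := eqVneq s tau.
  have st : s < tau by rewrite lt_neqAle s_tau.
  have Qst : Q s tau.
    apply/Qsym/Hd => //; rewrite distrC ger0_norm ?subr_ge0//.
    by rewrite ltrBlDr -ltrBlDl.
  split=> //; right; have [s0 _ [s00|Q0s]] := Ss; first by rewrite -s00.
  have [s00|s00] := eqVneq s 0; first by rewrite -s00.
  by apply: Qtrans Q0s Qst => //; rewrite lt_neqAle eq_sym s00.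
have tauE : tau = 1.
  apply/eqP; rewrite eq_le tau1 leNgt; apply/negP => tau_lt1.
  pose u := Num.min 1 (tau + d / 2).
  have utau : tau < u by rewrite lt_min tau_lt1 ltrDl divr_gt0.
  have u1 : u <= 1 by rewrite ge_min lexx.
  have : S u.
    split=> //; first by rewrite (le_trans tau0) ?ltW.
    right; have Qtu : Q tau u.
      apply: Hd; first by rewrite gt_eqF.
      rewrite gtr0_norm ?subr_gt0// ltrBlDl gt_min; apply/orP; right.
      by rewrite ltrD2l ltr_pdivrMr// ltr_pMr// ltr1n.
    have [_ _ [tau00|Q0t]] := Stau; first by rewrite -tau00.
    have [tau00|tau00] := eqVneq tau 0; first by rewrite -[X in Q X _]tau00.
    by apply: Qtrans Q0t Qtu => //; rewrite lt_neqAle eq_sym tau00.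
  by move/(sup_upper_bound hS); rewrite leNgt utau.
have [_ _ [|]] := Stau; rewrite tauE; first by move/eqP; rewrite oner_eq0.
by rewrite /Q /g subr0 invr1 !scale1r scale0r addr0.
Qed.

Lemma is_dirder_rescale (f : E -> F) x h l (t : R) : t != 0 ->
  is_dirder f x h l -> is_dirder (fun z => t^-1 *: f z) x (t *: h) l.
Proof.
move=> t0 fl A nA; have /dnear0P[e e0 He] := fl A nA.
apply/dnear0P; exists (e / `|t|); first by rewrite divr_gt0// normr_gt0.
move=> u u0 ue; rewrite /= -scalerBr !scalerA -invfM.
apply: He; first by rewrite mulf_neq0.
by rewrite normrM -ltr_pdivlMr// normr_gt0.
Qed.

(** Local uniformity of difference quotients: if the derivatives of [f q] in
    direction h are near l all along short segments starting at [X q], then so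
    are the difference quotients, by the mean value estimate on such a segment.
    The base point varies with q since sums of directions and mixed second
    differences need this. *)
Lemma quotient_cvg (T : Type) (H : set_system T) (f : T -> E -> F) (X : T -> E)
    h (l : F) : Filter H ->
  (forall A, nbhs l A -> \forall q \near H & s \near (0 : R),
     exists2 l', A l' & is_dirder (f q) (X q + s *: h) h l') ->
  forall A, nbhs l A -> \forall q \near H & t \near 0^',
    A (t^-1 *: (f q (X q + t *: h) - f q (X q))).
Proof.
move=> FH der A nA; have [C [oC Cl CA cC]] := nbhs_convex nA.
have [[B D] /= [HB /near0P[d d0 Dd]] BD] := der C (open_nbhs_nbhs (conj oC Cl)).
exists (B, [set t : R | t != 0 /\ `|t| < d]).
  by split => //; apply/dnear0P; exists d.
move=> [q t] /= [Bq [t0 td]]; apply: CA.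
rewrite scalerBr; apply: (@mean_value_convex (fun z => t^-1 *: f q z)) => //.
move=> s s0 s1; have /(BD (q, s * t))/= : B q /\ D (s * t).
  split => //; apply: Dd; rewrite normrM ger0_norm//.
  by apply: le_lt_trans td; rewrite ler_piMl.
by rewrite scalerA => -[l' Cl' fl']; exists l' => //; exact: is_dirder_rescale.
Qed.

(** Differentiation commutes with a limit along G as soon as the derivatives
    converge uniformly on short segments: [quotient_cvg] bounds the difference
    quotients of [f q] uniformly in q, and the bound survives the pointwise
    limit. *)
Lemma is_dirder_limit (T : Type) (G : set_system T) (f : T -> E -> F)
    (f0 : E -> F) x h (l : F) : ProperFilter G ->
  (forall A, nbhs l A -> \forall q \near G & s \near (0 : R),
     exists2 l', A l' & is_dirder (f q) (x + s *: h) h l') ->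
  (\forall t \near (0 : R), f^~ (x + t *: h) @ G --> f0 (x + t *: h)) ->
  is_dirder f0 x h l.
Proof.
move=> PG der flim A nA; have [B nB BA] := nbhs_closure nA.
have [[P D] /= [GP nD] PD] := @quotient_cvg _ _ f (fun=> x) h l _ der B nB.
have f0x : f^~ x @ G --> f0 x.
  by have := nbhs_singleton flim; rewrite scale0r addr0.
have nD' : \forall t \near (0 : R)^',
    D t /\ f^~ (x + t *: h) @ G --> f0 (x + t *: h).
  by apply: filterI => //; exact: nbhs_dnbhs.
apply: filterS nD' => t [Dt ft]; apply: BA => M nM.
have : (fun q => t^-1 *: (f q (x + t *: h) - f q x)) @ G -->
    t^-1 *: (f0 (x + t *: h) - f0 x).
  by apply: lcs_cvgZ; exact: lcs_cvgB.
move=> /(_ M nM) GM.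
have {}GM : G [set q | M (t^-1 *: (f q (x + t *: h) - f q x))] by [].
have [q [Mq Pq]] := filter_ex (filterI GM GP).
by exists (t^-1 *: (f q (x + t *: h) - f q x)); split => //; exact: (PD (q, t)).
Qed.

Lemma is_dirder_quot (f g : E -> F) x h lf lg (a : R) :
  is_dirder f x h lf -> is_dirder g x h lg ->
  is_dirder (fun z => a *: (f z - g z)) x h (a *: (lf - lg)).
Proof.
move=> ff gg.
rewrite /is_dirder (_ : (fun t => _) = fun t : R => a *:
    (t^-1 *: (f (x + t *: h) - f x) - t^-1 *: (g (x + t *: h) - g x))).
  by apply: lcs_cvgZ; apply: lcs_cvgB.
apply/funext => t; rewrite -!scalerBr !scalerA mulrC; congr (_ *: _).
by rewrite !opprD !opprK addrACA.
Qed.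

End mean_value.

(** * Jets of differentiable maps *)

Section iterated_derivatives.
Context (R : realType) (E : lmodType R) (F : lcsType R).

Lemma iter_dirder_rcons (f : E -> F) ys y :
  iter_dirder f (rcons ys y) = dirder (iter_dirder f ys) y.
Proof. by elim: ys f => //= z ys IH f; exact: IH. Qed.

Lemma iter_dirderivable_rcons O (f : E -> F) ys y :
  iter_dirderivable O f (rcons ys y) <->
  iter_dirderivable O f ys /\ forall x, O x -> dirderivable (iter_dirder f ys) x y.
Proof.
elim: ys f => [|z ys IH] f /=; first by tauto.
by split=> [[fz /IH[fys fy]]|[[fz fys] fy]]; split=> //; apply/IH.
Qed.

End iterated_derivatives.

Definition dirs (E : Type) k (y : 'I_k -> E) : seq E := [seq y i | i <- enum 'I_k].

(** Directions are handled as sequences, because the order of derivation grows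
    in the inductions below; [dirs] and [seq_dirs] translate to and from the
    topological products {ptws 'I_k -> E}. *)
Definition seq_dirs (E : nmodType) k (ys : seq E) : {ptws 'I_k -> E} :=
  fun i => nth 0 ys i.
Arguments seq_dirs {E} k ys.

Section dirs.
Context (E : nmodType).

Lemma size_dirs k (y : 'I_k -> E) : size (dirs y) = k.
Proof. by rewrite size_map size_enum_ord. Qed.

Lemma seq_dirsK k (y : 'I_k -> E) : seq_dirs k (dirs y) = y.
Proof.
apply/funext => i; rewrite /seq_dirs (nth_map i) ?size_enum_ord//.
by rewrite nth_ord_enum.
Qed.

Lemma dirsK k (ys : seq E) : size ys = k -> dirs (seq_dirs k ys) = ys.
Proof.
move=> sk; apply: (@eq_from_nth _ 0); rewrite size_dirs// => i ik.
by rewrite (nth_map (Ordinal ik)) ?size_enum_ord// /seq_dirs nth_enum_ord.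
Qed.

End dirs.

Section subset_points.
Context (R : realType) (E F : lcsType R) (U : lcSubset E).

Lemma zero_ext_val (f : U -> F) (x : U) : zero_ext f (\val x) = f x.
Proof.
by have := congr1 (@^~ x) (@valLK _ _ (0 : F) (lc_set U) f).
Qed.

Lemma interior_val (z : E) : U° z -> exists x : U, \val x = z.
Proof. by move=> /interior_subset Uz; exists (exist _ z (mem_set Uz)). Qed.

Lemma interior_ind (P : E -> Prop) :
  (forall x : U, U° (\val x) -> P (\val x)) -> forall z, U° z -> P z.
Proof. by move=> H z Uz; have [x xE] := interior_val Uz; rewrite -xE in Uz *; exact: H. Qed.

Lemma nbhs_val (x : U) (B : set U) : nbhs x B ->
  exists2 W : set E, nbhs (\val x) W & forall z : U, W (\val z) -> B z.
Proof.
move=> [_ [[W oW <-] Wx] WB]; exists W; last by move=> z; exact: WB.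
exact: open_nbhs_nbhs.
Qed.

Lemma val_continuous : continuous (fun x : U => \val x : E).
Proof. exact: initial_continuous. Qed.

Lemma near_interior (x : U) (B : set U) : U° (\val x) -> nbhs x B ->
  \forall e \near \val x, exists z : U, [/\ U° (\val z), \val z = e & B z].
Proof.
move=> Ux /nbhs_val[W nW WB].
have : \forall e \near \val x, U° e /\ W e.
  by apply: filterI => //; apply: open_nbhs_nbhs; split => //; exact: open_interior.
apply: filterS => e [Ue We]; move: e Ue We; apply: interior_ind => z Uz Wz.
by exists z; split => //; exact: WB.
Qed.

(** The interior of U is dense in U and F is Hausdorff. *)
Lemma dense_eq (g h : U -> F) : continuous g -> continuous h ->
  (forall x : U, U° (\val x) -> g x = h x) -> forall x, g x = h x.
Proof.
move=> cg ch gh x; apply: (@hausdorff_spaceT R F) => A B nA nB.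
have /Defs.closure_interior_val[z [Uz [Az Bz]]] :
    nbhs x (g @^-1` A `&` h @^-1` B) by apply: filterI; [exact: cg|exact: ch].
by exists (g z); split => //; rewrite gh.
Qed.

End subset_points.

(** Continuity on O, an open set of points of the ambient space X, can be tested
    after pulling back along the inclusion v of the subset D, because O consists
    of points of D and v is a topological embedding. *)
Lemma within_continuous_val (X D Y T : topologicalType) (v : D -> X) (O : set X)
    (g : D * Y -> T) (h : X * Y -> T) : open O ->
  (forall z, O z -> exists x, v x = z) ->
  (forall x B, nbhs x B -> exists2 W, nbhs (v x) W & forall z, W (v z) -> B z) ->
  (forall x y, O (v x) -> h (v x, y) = g (x, y)) -> continuous g ->
  {within O `*` setT, continuous h}.
Proof.
move=> oO Ov nv hg cg.
have oOT : open (O `*` [set: Y]).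
  rewrite openE => -[z y] [Oz _]; exists (O, setT) => //=.
  by split; [exact: open_nbhs_nbhs|exact: filterT].
rewrite continuous_open_subspace// => -[z y] /set_mem[/= Oz _].
have [x xz] := Ov z Oz; rewrite -xz in Oz *.
move=> N; rewrite hg// => nN; have [[B C] /= [nB nC] BC] := cg (x, y) N nN.
have [W nW WB] := nv x B nB.
exists (W `&` O, C) => /=.
  by split => //; apply: filterI => //; exact: open_nbhs_nbhs.
move=> [z' y'] /= [[Wz' Oz'] Cy']; have [x' x'z'] := Ov z' Oz'.
rewrite -x'z' in Wz' Oz' *; rewrite hg//.
by apply: (BC (x', y')); split => //; exact: WB.
Qed.

Lemma leq_ooW k l r : (k <= l)%N -> leq_oo l r -> leq_oo k r.
Proof. by case: r => //= n kl; exact: leq_trans. Qed.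

Section jets.
Context (R : realType) (E F : lcsType R) (U : lcSubset E) (r : option nat).

(** [D x [:: y1; ..; yk]] plays the role of the extended derivative
    d^(k) f (x, y1, .., yk). The recursion is on the last direction, the one
    applied last, so that each function [D^~ ys] has to be differentiated only
    once. *)
Record jet (f : U -> F) (D : U -> seq E -> F) : Prop := Jet {
  jet0 : forall x, D x [::] = f x;
  jet_continuous : forall k, leq_oo k r ->
    continuous (fun p : U * {ptws 'I_k -> E} => D p.1 (dirs p.2));
  jet_dirder : forall x ys h, leq_oo (size ys).+1 r -> U° (\val x) ->
    is_dirder (zero_ext (fun z : U => D z ys)) (\val x) h (D x (rcons ys h)) }.

(** Directional derivatives at interior points depend only on the values on the
    interior. *)
Lemma is_dirder_zero_ext (f : E -> F) (g : U -> F) (x : U) h l :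
  (forall z : U, U° (\val z) -> f (\val z) = g z) -> U° (\val x) ->
  is_dirder (zero_ext g) (\val x) h l -> is_dirder f (\val x) h l.
Proof.
move=> fg Ux; apply: (Defs.is_dirder_eq (open_interior U)) => //.
move=> z /set_mem; move: z; apply: interior_ind => z Uz.
by rewrite zero_ext_val fg.
Qed.

Lemma jet_iter_dirder f D ys : jet f D -> leq_oo (size ys) r ->
  iter_dirderivable U° (zero_ext f) ys /\
  forall x : U, U° (\val x) -> iter_dirder (zero_ext f) ys (\val x) = D x ys.
Proof.
move=> jD; elim/last_ind: ys => [|ys y IH].
  by move=> _; split => // x _; rewrite /= zero_ext_val (jet0 jD).
rewrite size_rcons => yr; have [Hys ysE] := IH (leq_ooW (leqnSn _) yr).
have Hy (x : U) : U° (\val x) ->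
    is_dirder (iter_dirder (zero_ext f) ys) (\val x) y (D x (rcons ys y)).
  by move=> Ux; apply: (is_dirder_zero_ext ysE Ux); exact: (jet_dirder jD).
split.
  apply/iter_dirderivable_rcons; split => //; apply: interior_ind => x Ux.
  by exists (D x (rcons ys y)); exact: Hy.
move=> x Ux; rewrite iter_dirder_rcons; apply: Defs.is_dirder_dirder.
exact: Hy.
Qed.

Lemma jet_diffk_extension f D k : jet f D -> leq_oo k r ->
  @diffk_extension R E F U k f (fun p => D p.1 (dirs p.2)).
Proof.
move=> jD kr; split.
- exact: (jet_continuous jD).
- move=> x y Ux /=; have yr : leq_oo (size (dirs y)) r by rewrite size_dirs.
  by have [_ <-] := jet_iter_dirder jD yr.
- move=> k0 x y; rewrite -(jet0 jD) /=; congr (D _ _).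
  by apply/size0nil; rewrite size_dirs.
Qed.

(** Together with [diff_jetP]: a map is C^r if and only if it has a jet of order
    r, and by [jet_diffk] the jet then consists of its derivatives. *)
Lemma jet_Cr_map f D : jet f D -> Cr_map r f.
Proof.
move=> jD; split => k kr; last first.
  by exists (fun p => D p.1 (dirs p.2)); exact: jet_diffk_extension.
split=> [y|].
  have yr : leq_oo (size (dirs y)) r by rewrite size_dirs.
  by have [] := jet_iter_dirder jD yr.
refine (@within_continuous_val E U {ptws 'I_k -> E} F (fun x : U => \val x) U°
  (fun p => D p.1 (dirs p.2)) (@iter_diff R E F k (zero_ext f)) _ _ _ _ _).
- exact: open_interior.
- exact: interior_val.
- exact: nbhs_val.
- by move=> x y Ux /=; have [_ <-] := jet_diffk_extension jD kr.
- exact: (jet_continuous jD).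
Qed.

Lemma jet_diffk f D k (p : U * {ptws 'I_k -> E}) : jet f D -> leq_oo k r ->
  @diffk R E F U k f p = D p.1 (dirs p.2).
Proof.
move=> jD kr.
by rewrite (Defs.diff_unique kr (jet_Cr_map jD) (jet_diffk_extension jD kr)).
Qed.

(** The jet made of the derivatives themselves. For sequences longer than r it
    takes unspecified values. *)
Definition diff_jet (f : U -> F) (x : U) (ys : seq E) : F :=
  @diffk R E F U (size ys) f (x, seq_dirs (size ys) ys).

Lemma diff_jetE f x ys k : size ys = k ->
  diff_jet f x ys = @diffk R E F U k f (x, seq_dirs k ys).
Proof. by rewrite /diff_jet => <-. Qed.

Lemma diff_jetP f : Cr_map r f -> jet f (diff_jet f).
Proof.
move=> Hf; have r0 : leq_oo 0 r by case: r.
have dE ys (x : U) : leq_oo (size ys) r -> U° (\val x) ->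
    diff_jet f x ys = iter_dirder (zero_ext f) ys (\val x).
  move=> yr Ux; have [_ dE _] := Defs.diffP yr Hf.
  by rewrite /diff_jet dE// /iter_diff /= -[map _ _]/(dirs _) dirsK.
split.
- by move=> x; have [_ _ d0] := Defs.diffP r0 Hf; rewrite /diff_jet d0.
- move=> k kr; rewrite (_ : (fun p => _) = @diffk R E F U k f).
    by have [] := Defs.diffP kr Hf.
  apply/funext => -[x y] /=; rewrite (@diff_jetE _ _ _ k) ?size_dirs//.
  by rewrite seq_dirsK.
- move=> x ys h ysr Ux.
  have ysr' := leq_ooW (leqnSn _) ysr.
  rewrite dE ?size_rcons// iter_dirder_rcons.
  have [+ _] := Hf.1 _ ysr; move=> /(_ (seq_dirs _ (rcons ys h))).
  rewrite -[map _ _]/(dirs _) dirsK ?size_rcons//.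
  move=> /iter_dirderivable_rcons[_ /(_ _ Ux)/Defs.dirderP].
  apply: (Defs.is_dirder_eq (open_interior U)) => //.
  move=> z /set_mem; move: z; apply: interior_ind => z Uz.
  by rewrite zero_ext_val dE.
Qed.

End jets.

(** * Jets of maps on products *)

Section jets2.
Context (R : realType) (E1 E2 F : lcsType R).
Context (U : lcSubset E1) (V : lcSubset E2) (r s : option nat).

(** As in [jet], with directions ws in the first factor and vs in the second.
    The derivatives in the second factor are taken first, whence
    [jet2_dirder2] only for empty ws; see [jet2_interior_dirder2] for
    the other order. *)
Record jet2 (f : U * V -> F) (D : U -> V -> seq E1 -> seq E2 -> F) : Prop := Jet2 {
  jet20 : forall x y, D x y [::] [::] = f (x, y);
  jet2_continuous : forall i j, leq_oo i r -> leq_oo j s ->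
    continuous (fun p : (U * V) * ({ptws 'I_i -> E1} * {ptws 'I_j -> E2}) =>
      D p.1.1 p.1.2 (dirs p.2.1) (dirs p.2.2));
  jet2_dirder2 : forall x y vs v, leq_oo (size vs).+1 s ->
    U° (\val x) -> V° (\val y) ->
    is_dirder (zero_ext (fun z : V => D x z [::] vs)) (\val y) v
      (D x y [::] (rcons vs v));
  jet2_dirder1 : forall x y ws vs w, leq_oo (size ws).+1 r -> leq_oo (size vs) s ->
    U° (\val x) -> V° (\val y) ->
    is_dirder (zero_ext (fun z : U => D z y ws vs)) (\val x) w
      (D x y (rcons ws w) vs) }.

Definition dirs2 (ws : seq E1) (vs : seq E2) : seq (E1 * E2) :=
  [seq (0, v) | v <- vs] ++ [seq (w, 0) | w <- ws].

Let O : set (E1 * E2) := U° `*` V°.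
Let vals (q : U * V) : E1 * E2 := (\val q.1, \val q.2).

Lemma zero_ext2_val (g : U * V -> F) q : zero_ext2 g (vals q) = g q.
Proof. by rewrite /zero_ext2 zero_ext_val zero_ext_val; case: q. Qed.

Lemma zero_ext2_vall (g : U * V -> F) (x : U) z :
  zero_ext2 g (\val x, z) = zero_ext (fun y => g (x, y)) z.
Proof. by rewrite /zero_ext2 zero_ext_val. Qed.

Lemma zero_ext2_valr (g : U * V -> F) (y : V) z :
  zero_ext2 g (z, \val y) = zero_ext (fun x => g (x, y)) z.
Proof.
rewrite /zero_ext2 /=; congr (zero_ext _ z).
by apply/funext => x; rewrite zero_ext_val.
Qed.

(** Along a direction (0, v) only the partial map in the second variable is
    seen; symmetrically for [is_dirder_valr]. *)
Lemma is_dirder_vall (g : U * V -> F) (x : U) (y : V) v l :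
  is_dirder (zero_ext2 g) (\val x, \val y) (0, v) l <->
  is_dirder (zero_ext (fun y => g (x, y))) (\val y) v l.
Proof.
rewrite /is_dirder; set a := fun t : R => _; set b := (fun t : R => _ in X in _ <-> X).
suff -> : a = b by [].
apply/funext => t; rewrite /a /b -!zero_ext2_vall; congr (_ *: (zero_ext2 g _ - _)).
by rewrite pair_equal_spec /= scaler0 addr0.
Qed.

Lemma is_dirder_valr (g : U * V -> F) (x : U) (y : V) w l :
  is_dirder (zero_ext2 g) (\val x, \val y) (w, 0) l <->
  is_dirder (zero_ext (fun x => g (x, y))) (\val x) w l.
Proof.
rewrite /is_dirder; set a := fun t : R => _; set b := (fun t : R => _ in X in _ <-> X).
suff -> : a = b by [].
apply/funext => t; rewrite /a /b -!zero_ext2_valr; congr (_ *: (zero_ext2 g _ - _)).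
by rewrite pair_equal_spec /= scaler0 addr0.
Qed.

Lemma interior_vals z : O z -> exists q, vals q = z.
Proof.
case: z => z1 z2 [/= /interior_val[x <-] /interior_val[y <-]].
by exists (x, y).
Qed.

Lemma interior_ind2 (P : E1 * E2 -> Prop) :
  (forall q, O (vals q) -> P (vals q)) -> forall z, O z -> P z.
Proof. by move=> H z Oz; have [q qE] := interior_vals Oz; rewrite -qE in Oz *; exact: H. Qed.

Lemma nbhs_vals (q : U * V) B : nbhs q B ->
  exists2 W, nbhs (vals q) W & forall z, W (vals z) -> B z.
Proof.
case: q => x y [[B1 B2] /= [/nbhs_val[W1 nW1 WB1] /nbhs_val[W2 nW2 WB2]] B12].
exists (W1 `*` W2); first by exists (W1, W2).
by move=> [x' y'] [/= /WB1 ? /WB2 ?]; apply: (B12 (x', y')).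
Qed.

Lemma is_dirder_zero_ext2 (f : E1 * E2 -> F) (g : U * V -> F) q h l :
  (forall q, O (vals q) -> f (vals q) = g q) -> O (vals q) ->
  is_dirder (zero_ext2 g) (vals q) h l -> is_dirder f (vals q) h l.
Proof.
move=> fg Oq; apply: (Defs.is_dirder_eq (@Defs.open_O R E1 E2 U V)) => //.
move=> z /set_mem; move: z; apply: interior_ind2 => z Oz.
by rewrite zero_ext2_val fg.
Qed.

Lemma jet2_iter_dirder f D ws vs : jet2 f D ->
  leq_oo (size ws) r -> leq_oo (size vs) s ->
  iter_dirderivable O (zero_ext2 f) (dirs2 ws vs) /\
  forall q, O (vals q) ->
    iter_dirder (zero_ext2 f) (dirs2 ws vs) (vals q) = D q.1 q.2 ws vs.
Proof.
move=> jD + vss; elim/last_ind: ws => [_|ws w IH]; rewrite /dirs2.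
  rewrite /= cats0; elim/last_ind: vs vss => [_|vs v IH].
    by split => // q _; rewrite /= zero_ext2_val (jet20 jD) -surjective_pairing.
  rewrite size_rcons map_rcons => vs1.
  have [Hvs vsE] := IH (leq_ooW (leqnSn _) vs1).
  have Hv q : O (vals q) -> is_dirder
      (iter_dirder (zero_ext2 f) [seq (0, v0) | v0 <- vs]) (vals q) (0, v)
      (D q.1 q.2 [::] (rcons vs v)).
    move=> Oq; apply: (is_dirder_zero_ext2 vsE Oq); apply/is_dirder_vall.
    by apply: (jet2_dirder2 jD) => //; case: Oq.
  split.
    apply/iter_dirderivable_rcons; split => //; apply: interior_ind2 => q Oq.
    by exists (D q.1 q.2 [::] (rcons vs v)); exact: Hv.
  move=> q Oq; rewrite iter_dirder_rcons; apply: Defs.is_dirder_dirder.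
  exact: Hv.
rewrite size_rcons map_rcons -rcons_cat => wr.
have [Hws wsE] := IH (leq_ooW (leqnSn _) wr).
have Hw q : O (vals q) -> is_dirder
    (iter_dirder (zero_ext2 f) (dirs2 ws vs)) (vals q) (w, 0)
    (D q.1 q.2 (rcons ws w) vs).
  move=> Oq; apply: (is_dirder_zero_ext2 wsE Oq); apply/is_dirder_valr.
  by apply: (jet2_dirder1 jD) => //; case: Oq.
split.
  apply/iter_dirderivable_rcons; split => //; apply: interior_ind2 => q Oq.
  by exists (D q.1 q.2 (rcons ws w) vs); exact: Hw.
move=> q Oq; rewrite iter_dirder_rcons; apply: Defs.is_dirder_dirder.
exact: Hw.
Qed.

Lemma dirs2E i j (w : 'I_i -> E1) (v : 'I_j -> E2) :
  [seq (0, v b) | b <- enum 'I_j] ++ [seq (w a, 0) | a <- enum 'I_i] =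
  dirs2 (dirs w) (dirs v).
Proof. by rewrite /dirs2 /dirs -!map_comp. Qed.

Lemma jet2_diffk2_extension f D i j : jet2 f D -> leq_oo i r -> leq_oo j s ->
  @diffk2_extension R E1 E2 F U V i j f
    (fun p => D p.1.1 p.1.2 (dirs p.2.1) (dirs p.2.2)).
Proof.
move=> jD ir js; split.
- exact: (jet2_continuous jD).
- move=> x y [w v] Ux Vy /=; rewrite /iter_diff2 /= dirs2E.
  have wr : leq_oo (size (dirs w)) r by rewrite size_dirs.
  have vs : leq_oo (size (dirs v)) s by rewrite size_dirs.
  by have [_ /(_ (x, y)) ->] := jet2_iter_dirder jD wr vs.
- move=> i0 j0 x y [w v]; rewrite -(jet20 jD) /=.
  by congr (D _ _ _ _); apply/size0nil; rewrite size_dirs.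
Qed.

Lemma jet2_Crs_map f D : jet2 f D -> Crs_map r s f.
Proof.
move=> jD; split => i j ir js; last first.
  exists (fun p => D p.1.1 p.1.2 (dirs p.2.1) (dirs p.2.2)).
  exact: jet2_diffk2_extension.
split=> [w v|].
  have wr : leq_oo (size (dirs w)) r by rewrite size_dirs.
  have vs : leq_oo (size (dirs v)) s by rewrite size_dirs.
  by rewrite dirs2E; have [] := jet2_iter_dirder jD wr vs.
refine (@within_continuous_val (E1 * E2)%type (U * V)%type
  ({ptws 'I_i -> E1} * {ptws 'I_j -> E2})%type F vals O
  (fun p => D p.1.1 p.1.2 (dirs p.2.1) (dirs p.2.2))
  (@iter_diff2 R E1 E2 F i j (zero_ext2 f)) _ _ _ _ _).
- exact: Defs.open_O.
- exact: interior_vals.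
- exact: nbhs_vals.
- move=> [x y] wv [Ux Vy] /=.
  by have [_ dE _] := jet2_diffk2_extension jD ir js; rewrite -dE.
- exact: (jet2_continuous jD).
Qed.

Definition diff_jet2 (f : U * V -> F) (x : U) (y : V) ws vs : F :=
  @diffk2 R E1 E2 F U V (size ws) (size vs) f
    ((x, y), (seq_dirs (size ws) ws, seq_dirs (size vs) vs)).

Lemma diff_jet2E f x y ws vs i j : size ws = i -> size vs = j ->
  diff_jet2 f x y ws vs =
  @diffk2 R E1 E2 F U V i j f ((x, y), (seq_dirs i ws, seq_dirs j vs)).
Proof. by rewrite /diff_jet2 => <- <-. Qed.

Lemma diff_jet2P f : Crs_map r s f -> jet2 f (diff_jet2 f).
Proof.
move=> Hf; have [r0 s0] : leq_oo 0 r /\ leq_oo 0 s by case: r s => [?|] [?|].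
have dE ws vs q : leq_oo (size ws) r -> leq_oo (size vs) s -> O (vals q) ->
    diff_jet2 f q.1 q.2 ws vs =
    iter_dirder (zero_ext2 f) (dirs2 ws vs) (vals q).
  move=> wr vss [Ux Vy]; have [_ dE _] := Defs.diffk2P wr vss Hf.
  by rewrite /diff_jet2 dE// /iter_diff2 /= dirs2E !dirsK.
have der ws vs : leq_oo (size ws) r -> leq_oo (size vs) s ->
    iter_dirderivable O (zero_ext2 f) (dirs2 ws vs).
  move=> wr vss; have [+ _] := Hf.1 _ _ wr vss.
  by move=> /(_ (seq_dirs _ ws) (seq_dirs _ vs)); rewrite dirs2E !dirsK.
split.
- by move=> x y; have [_ _ d0] := Defs.diffk2P r0 s0 Hf; rewrite /diff_jet2 d0.
- move=> i j ir js; rewrite (_ : (fun p => _) = @diffk2 R E1 E2 F U V i j f).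
    by have [] := Defs.diffk2P ir js Hf.
  apply/funext => -[[x y] [w v]] /=.
  by rewrite (@diff_jet2E _ _ _ _ _ i j) ?size_dirs// !seq_dirsK.
- move=> x y vs v vss Ux Vy; have vss' := leq_ooW (leqnSn _) vss.
  have Oxy : O (vals (x, y)) by [].
  rewrite (dE [::] (rcons vs v) (x, y)) ?size_rcons//.
  have := der [::] (rcons vs v); rewrite size_rcons => /(_ r0 vss).
  rewrite /dirs2 /= !cats0 map_rcons iter_dirder_rcons.
  move=> /iter_dirderivable_rcons[_ /(_ _ Oxy)/Defs.dirderP].
  move=> H; apply/(is_dirder_vall (fun q => diff_jet2 f q.1 q.2 [::] vs)).
  apply: (Defs.is_dirder_eq (@Defs.open_O R E1 E2 U V)) H => //.
  move=> z /set_mem; move: z; apply: interior_ind2 => z Oz.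
  by rewrite zero_ext2_val dE// /dirs2 cats0.
- move=> x y ws vs w wr vss Ux Vy; have wr' := leq_ooW (leqnSn _) wr.
  have Oxy : O (vals (x, y)) by [].
  rewrite (dE (rcons ws w) vs (x, y)) ?size_rcons//.
  have := der (rcons ws w) vs; rewrite size_rcons => /(_ wr vss).
  rewrite /dirs2 map_rcons -rcons_cat iter_dirder_rcons.
  move=> /iter_dirderivable_rcons[_ /(_ _ Oxy)/Defs.dirderP].
  move=> H; apply/(is_dirder_valr (fun q => diff_jet2 f q.1 q.2 ws vs)).
  apply: (Defs.is_dirder_eq (@Defs.open_O R E1 E2 U V)) H => //.
  move=> z /set_mem; move: z; apply: interior_ind2 => z Oz.
  by rewrite zero_ext2_val dE.
Qed.

End jets2.

(** * Symmetry and multilinearity of higher derivatives *)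

Section mixed_derivatives.
Context (R : realType) (E : lmodType R) (F : lcsType R).

Lemma is_dirderZ (g : E -> F) x h l (a : R) :
  is_dirder g x h l -> is_dirder g x (a *: h) (a *: l).
Proof.
move=> gl; have [->|a0] := eqVneq a 0.
  rewrite !scale0r /is_dirder (_ : (fun t : R => _) = fun=> 0); first exact: cvg_cst.
  by apply/funext => t; rewrite scaler0 addr0 subrr scaler0.
apply: cvg_trans (lcs_cvgZ (a := a) (is_dirder_rescale a0 gl)).
apply: near_eq_cvg; apply: nearW => t.
by rewrite -scalerBr !scalerA mulrAC divff// mul1r.
Qed.

(** Split the increment in direction t(a + b) at x + ta: the first part yields
    la, and the second one, a quotient in direction b with the moving base point
    x + ta, yields lb by [quotient_cvg]. *)
Lemma is_dirderD (g : E -> F) x a b la (lb : F) : is_dirder g x a la ->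
  (forall A, nbhs lb A -> \forall t \near (0 : R) & s \near (0 : R),
     exists2 l, A l & is_dirder g (x + t *: a + s *: b) b l) ->
  is_dirder g x (a + b) (la + lb).
Proof.
move=> ga gb.
have gb' : (fun t : R => t^-1 *: (g (x + t *: a + t *: b) - g (x + t *: a)))
    @ 0^' --> lb.
  move=> A nA.
  have [[B D] /= [nB nD] BD] := @quotient_cvg R E F R (nbhs (0 : R)) (fun=> g)
    (fun t => x + t *: a) b lb _ gb A nA.
  have nBD : \forall t \near (0 : R)^', B t /\ D t.
    by apply: filterI => //; exact: nbhs_dnbhs.
  by apply: filterS nBD => t [Bt Dt]; apply: (BD (t, t)).
apply: cvg_trans (lcs_cvgD ga gb').
apply: near_eq_cvg; apply: nearW => t; rewrite -scalerDr; congr (_ *: _).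
by rewrite scalerDr (addrA x) [LHS]addrC [LHS]addrA subrK.
Qed.

(** A form of Schwarz's theorem which also gives the existence of the second
    mixed derivative: ga is the limit of the difference quotients of g in
    direction a; these have derivatives in direction b given by the
    difference quotients of gb, which converge uniformly by [quotient_cvg], so
    that [is_dirder_limit] applies. *)
Lemma is_dirder_exchange (g ga gb : E -> F) x a b (l : F) :
  (\forall s \near (0 : R), is_dirder g (x + s *: b) a (ga (x + s *: b))) ->
  (\forall s \near (0 : R) & t \near (0 : R),
     is_dirder g (x + s *: b + t *: a) b (gb (x + s *: b + t *: a))) ->
  (forall A, nbhs l A -> \forall s \near (0 : R) & t \near (0 : R),
     exists2 l', A l' & is_dirder gb (x + s *: b + t *: a) a l') ->
  is_dirder ga x b l.
Proof.
move=> Hga [[P Q] /= [nP nQ] PQ] Hgb.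
pose f (t : R) z := t^-1 *: (g (z + t *: a) - g z).
apply: (@is_dirder_limit R E F R 0^' f) => // A nA.
have [[B D] /= [nB nD] BD] := @quotient_cvg R E F R (nbhs (0 : R)) (fun=> gb)
    (fun s => x + s *: b) a l _ Hgb A nA.
have nQ0 := nbhs_singleton nQ.
exists (D `&` Q, B `&` P).
  by split; apply: filterI => //; exact: nbhs_dnbhs.
move=> [t s] /= [[Dt Qt] [Bs Ps]].
exists (t^-1 *: (gb (x + s *: b + t *: a) - gb (x + s *: b))).
  exact: (BD (s, t)).
apply: is_dirder_quot.
  have := PQ (s, t) (conj Ps Qt); rewrite /is_dirder.
  by under eq_fun do rewrite addrAC.
by have := PQ (s, 0) (conj Ps nQ0); rewrite /= scale0r addr0.
Qed.

End mixed_derivatives.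

(** Adjacent transpositions generate all permutations. *)
Lemma perm_adjacent (T : eqType) (Z : Type) (f : seq T -> Z) :
  (forall p a b q, f (p ++ a :: b :: q) = f (p ++ b :: a :: q)) ->
  forall s1 s2, perm_eq s1 s2 -> f s1 = f s2.
Proof.
move=> fab; have move_in p s a q : f (p ++ a :: s ++ q) = f (p ++ s ++ a :: q).
  by elim: s p => //= b s IH p; rewrite fab -cat_rcons IH cat_rcons.
suff H s1 s2 p : perm_eq s1 s2 -> f (p ++ s1) = f (p ++ s2).
  by move=> s1 s2; exact: (H _ _ [::]).
elim: s1 s2 p => [|a s1 IH] s2 p; first by rewrite perm_sym => /perm_nilP ->.
move=> s12; have a_s2 : a \in s2 by rewrite -(perm_mem s12) mem_head.
case/path.splitPr: a_s2 s12 => q1 q2 s12.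
rewrite -move_in -cat_rcons (IH (q1 ++ q2)) ?cat_rcons//.
by move: s12; rewrite perm_sym -cat1s perm_catCA /= perm_cons perm_sym.
Qed.

Section jet_symmetry.
Context (R : realType) (E F : lcsType R) (U : lcSubset E) (r : option nat).
Context (f : U -> F) (D : U -> seq E -> F).
Hypothesis jD : jet r f D.

Lemma jet_cvg ys : leq_oo (size ys) r -> continuous (fun x => D x ys).
Proof.
move=> yr x; rewrite /continuous_at -(dirsK (erefl (size ys))).
have := @jet_continuous _ _ _ _ _ _ _ jD _ yr (x, seq_dirs (size ys) ys).
rewrite /continuous_at /= => cD.
have cp : {for x, continuous (fun z : U => (z, seq_dirs (size ys) ys))}.
  by apply: continuous_at_pair; [exact: cvg_id|exact: cst_continuous].
exact: (cvg_comp _ _ cp cD).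
Qed.

Lemma near_jet_dirder (x : U) ys a b h A : leq_oo (size ys).+1 r -> U° (\val x) ->
  nbhs (D x (rcons ys h)) A ->
  \forall s \near (0 : R) & t \near (0 : R),
    exists2 l, A l & is_dirder (zero_ext (D^~ ys)) (\val x + s *: a + t *: b) h l.
Proof.
move=> yr Ux nA.
have /(near_interior Ux) : nbhs x (fun z => A (D z (rcons ys h))).
  by apply: (jet_cvg _ nA); rewrite size_rcons.
move=> /(near_line2 a b); apply: filterS => p /= [z [Uz <- Az]].
by exists (D z (rcons ys h)) => //; exact: (jet_dirder jD).
Qed.

Lemma near_jet_val (x : U) ys a b h : leq_oo (size ys).+1 r -> U° (\val x) ->
  \forall s \near (0 : R) & t \near (0 : R),
    is_dirder (zero_ext (D^~ ys)) (\val x + s *: a + t *: b) h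
      (zero_ext (D^~ (rcons ys h)) (\val x + s *: a + t *: b)).
Proof.
move=> yr Ux; have H := near_interior Ux (@filterT _ _ (nbhs_filter x)).
apply: filterS (near_line2 a b H) => p /= [z [Uz <- _]].
by rewrite zero_ext_val; exact: (jet_dirder jD).
Qed.

(** Linearity in the last direction is that of the directional derivative of a
    C^1 map at interior points, and extends to U by density. *)
Lemma jet_linear_last (x : U) ys a b (c : R) : leq_oo (size ys).+1 r ->
  D x (rcons ys (a + c *: b)) = D x (rcons ys a) + c *: D x (rcons ys b).
Proof.
move=> yr; have yr' h : leq_oo (size (rcons ys h)) r by rewrite size_rcons.
move: x; apply: dense_eq; first exact: jet_cvg.
  by apply: lcs_continuousD; last apply: lcs_continuousZ; apply: jet_cvg.
move=> x Ux.
apply: (Defs.is_dirder_unique (jet_dirder jD (h := a + c *: b) yr Ux)).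
apply: is_dirderD; first exact: (jet_dirder jD).
move=> A; have [->|c0] := eqVneq c 0.
  rewrite !scale0r => nA; exists (setT, setT); first by split; exact: filterT.
  move=> [s t] _ /=.
  exists 0; first exact: nbhs_singleton.
  rewrite /is_dirder (_ : (fun t : R => _) = fun=> 0); first exact: cvg_cst.
  by apply/funext => u; rewrite !scaler0 !addr0 subrr scaler0.
move=> nA.
have : nbhs (D x (rcons ys b)) ( *:%R c @^-1` A).
  by have := lcs_cvgZ (a := c) (@cvg_id _ (nbhs (D x (rcons ys b)))); apply.
move=> /(near_jet_dirder a (c *: b) yr Ux); apply: filterS => -[s t] /= [l Al Dl].
by exists (c *: l) => //; exact: is_dirderZ.
Qed.

Lemma jet_swap_last (x : U) ys a b : leq_oo (size ys).+2 r -> U° (\val x) ->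
  D x (rcons (rcons ys a) b) = D x (rcons (rcons ys b) a).
Proof.
move=> yr Ux; have yr' := leq_ooW (leqnSn _) yr.
have yr1 h : leq_oo (size (rcons ys h)).+1 r by rewrite size_rcons.
apply: (Defs.is_dirder_unique (jet_dirder jD (h := b) (yr1 a) Ux)).
apply: (@is_dirder_exchange _ _ _ (zero_ext (D^~ ys)) _ (zero_ext (D^~ (rcons ys b))) _ a).
- have [[B C] /= [nB nC] BC] := near_jet_val b a a yr' Ux.
  apply: filterS nB => s Bs; have /= := BC (s, 0) (conj Bs (nbhs_singleton nC)).
  by rewrite scale0r addr0.
- exact: near_jet_val.
- by move=> A nA; exact: near_jet_dirder.
Qed.

Lemma jet_swap_interior (x : U) p a b q : leq_oo (size (p ++ a :: b :: q)) r ->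
  U° (\val x) -> D x (p ++ a :: b :: q) = D x (p ++ b :: a :: q).
Proof.
elim/last_ind: q x => [|q h IH] x.
  rewrite size_cat addn2 => pr Ux.
  by rewrite -!cat_rcons !cats0 jet_swap_last.
have catE c d : p ++ c :: d :: rcons q h = rcons (p ++ c :: d :: q) h.
  by rewrite -!rcons_cons -rcons_cat.
rewrite !catE size_rcons => pr Ux.
have pr' : leq_oo (size (p ++ b :: a :: q)).+1 r by move: pr; rewrite !size_cat.
apply: (Defs.is_dirder_unique (jet_dirder jD (h := h) pr Ux)).
apply: (is_dirder_zero_ext _ Ux (jet_dirder jD (h := h) pr' Ux)) => z Uz.
by rewrite zero_ext_val IH//; exact: leq_ooW pr.
Qed.

(** The last two directions may be swapped by [is_dirder_exchange]; further
    derivations preserve this equality of functions on the interior, and density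
    extends it to U. *)
Lemma jet_perm (x : U) ys zs : leq_oo (size ys) r -> perm_eq ys zs -> D x ys = D x zs.
Proof.
move=> yr yz; pose D' ys := if leq_oo (size ys) r then D x ys else 0.
have <- : D' ys = D x ys by rewrite /D' yr.
have <- : D' zs = D x zs by rewrite /D' -(perm_size yz) yr.
apply: perm_adjacent yz => p a b q; rewrite /D'.
have <- : size (p ++ a :: b :: q) = size (p ++ b :: a :: q) by rewrite !size_cat.
case: ifPn => // pr; move: x {D'}; apply: dense_eq; first exact: jet_cvg.
  by apply: jet_cvg; move: pr; rewrite !size_cat.
by move=> x Ux; exact: jet_swap_interior.
Qed.

Lemma jet_linear (x : U) ys a b (c : R) : leq_oo (size ys).+1 r ->
  D x ((a + c *: b) :: ys) = D x (a :: ys) + c *: D x (b :: ys).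
Proof.
move=> yr; have consE h : D x (h :: ys) = D x (rcons ys h).
  by apply: jet_perm => //; rewrite perm_sym perm_rcons.
by rewrite !consE jet_linear_last.
Qed.

End jet_symmetry.

(** * Polarization *)

Section polynomial_coefficients.
Context (R : realType) (F : lcsType R) (Q : topologicalType).

Lemma lcs_continuous_sum n (c : nat -> Q -> F) :
  (forall l, (l < n)%N -> continuous (c l)) ->
  continuous (fun q => \sum_(l < n) c l q).
Proof.
elim: n => [|n IH] cc.
  by under eq_fun do rewrite big_ord0; exact: cst_continuous.
under eq_fun do rewrite big_ord_recr /=.
apply: lcs_continuousD; last exact: cc.
by apply: IH => l ln; apply: cc; exact: ltnW.
Qed.

(** If p(a) denotes the sum up to l = n, then p(2a) - 2^n p(a) has no term of degree n and
    its coefficients are (2^l - 2^n) c_l, with nonzero factors; so the claim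
    follows by induction on the degree. *)
Lemma continuous_coef n (c : nat -> Q -> F) :
  (forall a : R, continuous (fun q => \sum_(l < n) a ^+ l *: c l q)) ->
  forall l, (l < n)%N -> continuous (c l).
Proof.
elim: n c => // n IH c cc.
have cl l : (l < n)%N -> continuous (c l).
  move=> ln; pose k : R := 2 ^+ l - 2 ^+ n.
  have k0 : k != 0.
    by rewrite subr_eq0 lt_eqF// ltr_eXn2l ?ltr1n.
  have := IH (fun l q => (2 ^+ l - 2 ^+ n) *: c l q).
  move=> /(_ _ l ln) H; have -> : c l = fun q => k^-1 *: (k *: c l q).
    by apply/funext => q; rewrite scalerA mulVf// scale1r.
  apply: lcs_continuousZ; apply: H => a.
  have -> : (fun q => \sum_(l < n) a ^+ l *: ((2 ^+ l - 2 ^+ n) *: c l q)) =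
      fun q => \sum_(l < n.+1) (2 * a) ^+ l *: c l q -
               2 ^+ n *: \sum_(l < n.+1) a ^+ l *: c l q.
    apply/funext => q; rewrite !big_ord_recr /= scalerDr opprD addrACA.
    rewrite scalerA -exprMn subrr addr0 scaler_sumr -sumrB.
    apply: eq_bigr => i _.
    by rewrite exprMn !scalerA -scalerBl mulrBr ![_ * a ^+ _]mulrC.
  by apply: lcs_continuousB => //; exact: lcs_continuousZ.
move=> l; rewrite ltnS leq_eqVlt => /orP[/eqP ->|]; last exact: cl.
have -> : c n = fun q => \sum_(i < n.+1) 1 ^+ i *: c i q - \sum_(i < n) c i q.
  apply/funext => q; rewrite big_ord_recr /= expr1n scale1r.
  under eq_bigr do rewrite expr1n scale1r.
  by rewrite addrAC subrr add0r.
by apply: lcs_continuousB; [exact: cc|exact: lcs_continuous_sum].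
Qed.

End polynomial_coefficients.

Section polarization.
Context (R : realType) (E F : lcsType R).

Section expansion.
Context (f : seq E -> F) (N : nat).
Hypothesis f_perm : forall s1 s2, size s1 = N -> perm_eq s1 s2 -> f s1 = f s2.
Hypothesis f_linear : forall s a b (c : R), (size s).+1 = N ->
  f ((a + c *: b) :: s) = f (a :: s) + c *: f (b :: s).

(** The coefficient of a^l in f (z + a w, .., z + a w, us), with n entries
    z + a w, for a symmetric multilinear f: replace the entries one at a time,
    by z or, gaining a factor a, by w. *)
Fixpoint coef_expansion z w n (us : seq E) l : F :=
  if n is n'.+1 then
    coef_expansion z w n' (z :: us) l +
    (if l is l'.+1 then coef_expansion z w n' (w :: us) l' else 0)
  else if l is 0 then f us else 0.

Lemma coef_expansion_gt z w n us l : (n < l)%N -> coef_expansion z w n us l = 0.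
Proof.
elim: n us l => [|n IH] us [|l]//= nl.
by rewrite !IH ?addr0// ltnW.
Qed.

Lemma perm_nseq_rcons (z h : E) n us :
  perm_eq (h :: nseq n z ++ us) (nseq n z ++ h :: us).
Proof. by rewrite -cat1s perm_catCA /= perm_cat2l. Qed.

Lemma expansion z w n us (a : R) : (n + size us)%N = N ->
  f (nseq n (z + a *: w) ++ us) = \sum_(l < n.+1) a ^+ l *: coef_expansion z w n us l.
Proof.
elim: n us => [|n IH] us nN; first by rewrite big_ord1 expr0 scale1r.
rewrite /= f_linear ?size_cat ?size_nseq//.
rewrite !(f_perm _ (perm_nseq_rcons _ _ _ _)) ?IH /= ?size_cat ?size_nseq ?addnS//.
rewrite [RHS](eq_bigr (fun l : 'I_n.+2 => a ^+ l *: coef_expansion z w n (z :: us) l +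
  a ^+ l *: (if l : nat is l'.+1 then coef_expansion z w n (w :: us) l' else 0))); last first.
  by move=> l _; rewrite scalerDr.
rewrite big_split /=; congr (_ + _).
  by rewrite [RHS]big_ord_recr /= coef_expansion_gt// scaler0 addr0.
rewrite [RHS]big_ord_recl /= scaler0 add0r scaler_sumr.
by apply: eq_bigr => l _; rewrite scalerA -exprS.
Qed.

Lemma coef_expansion0 z w n us : (n + size us)%N = N ->
  coef_expansion z w n us 0 = f (nseq n z ++ us).
Proof.
elim: n us => //= n IH us nN; rewrite addr0 IH /= ?addnS//.
by apply/esym/f_perm; rewrite ?perm_nseq_rcons//= size_cat size_nseq.
Qed.

Lemma coef_expansion1 z w n us : (n.+1 + size us)%N = N ->
  coef_expansion z w n.+1 us 1 = n.+1%:R *: f (nseq n z ++ w :: us).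
Proof.
elim: n us => [|n IH] us nN; first by rewrite /= add0r scale1r.
rewrite -[LHS]/(coef_expansion z w n.+1 (z :: us) 1 +
  coef_expansion z w n.+1 (w :: us) 0).
rewrite IH ?coef_expansion0 /= ?addnS// -[n.+2%:R]natr1 scalerDl scale1r.
congr (_ *: _ + _); apply: f_perm.
  by rewrite size_cat size_nseq /= !addnS.
rewrite perm_sym -cat_cons -[z :: _]/(nseq n.+1 z) -cat1s -[w :: z :: _]cat1s.
rewrite perm_catCA perm_sym perm_catCA perm_cat2l /= perm_sym.
exact: perm_nseq_rcons.
Qed.

End expansion.

(** Starting from the diagonal, the arguments are made independent one at a
    time: the coefficient of a in the expansion of
    f (z + a u, .., z + a u, us) with n + 1 entries z + a u is n + 1 times
    f (z, .., z, u, us), and coefficients depend continuously on the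
    parameters by [continuous_coef]. *)
Lemma polarization (Q : topologicalType) (f : Q -> seq E -> F) N us :
  (forall q s1 s2, size s1 = N -> perm_eq s1 s2 -> f q s1 = f q s2) ->
  (forall q s a b (c : R), (size s).+1 = N ->
     f q ((a + c *: b) :: s) = f q (a :: s) + c *: f q (b :: s)) ->
  (forall z : Q -> E, continuous z -> continuous (fun q => f q (nseq N (z q)))) ->
  (size us <= N)%N -> (forall i, continuous (nth (fun=> 0) us i)) ->
  forall z : Q -> E, continuous z ->
  continuous (fun q => f q (nseq (N - size us) (z q) ++ [seq u q | u <- us])).
Proof.
move=> f_perm f_linear f_diag; elim: us => [|u us IH] /= usN cus z cz.
  by under eq_fun do rewrite cats0 subn0; exact: f_diag.
have {}IH z' : continuous z' ->
    continuous (fun q => f q (nseq (N - size us) (z' q) ++ [seq v q | v <- us])).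
  by apply: IH => [|i]; [exact: ltnW|exact: (cus i.+1)].
have nE : (N - size us = (N - (size us).+1).+1)%N by rewrite subnSK.
set n := (N - (size us).+1)%N in nE *; rewrite nE in IH.
have nN q : (n.+1 + size [seq v q | v <- us])%N = N.
  by rewrite size_map -nE subnK// ltnW.
have := @continuous_coef R F Q n.+2
  (fun l q => coef_expansion (f q) (z q) (u q) n.+1 [seq v q | v <- us] l).
move=> /(_ _ 1%N isT) H.
have {}H := lcs_continuousZ (a := n.+1%:R^-1) (H _).
rewrite (_ : (fun q => _) = fun q => n.+1%:R^-1 *:
    coef_expansion (f q) (z q) (u q) n.+1 [seq v q | v <- us] 1); last first.
  by apply/funext => q; rewrite (coef_expansion1 (f_perm q) _ _ (nN q)) scalerA mulVf ?scale1r.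
apply: H => a.
under eq_fun do rewrite -(expansion (f_perm _) (f_linear _) _ _ _ (nN _)).
apply: (IH (fun q => z q + a *: u q)); apply: lcs_continuousD => //.
by apply: lcs_continuousZ; exact: (cus 0).
Qed.

Lemma continuous_polarization (X : topologicalType) (f : X -> seq E -> F) N :
  (forall x s1 s2, size s1 = N -> perm_eq s1 s2 -> f x s1 = f x s2) ->
  (forall x s a b (c : R), (size s).+1 = N ->
     f x ((a + c *: b) :: s) = f x (a :: s) + c *: f x (b :: s)) ->
  continuous (fun p : X * E => f p.1 (nseq N p.2)) ->
  continuous (fun p : X * {ptws 'I_N -> E} => f p.1 (dirs p.2)).
Proof.
move=> f_perm f_linear f_diag.
pose us : seq (X * {ptws 'I_N -> E} -> E) := [seq (fun q => q.2 i) | i <- enum 'I_N].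
have sus : size us = N by rewrite size_map size_enum_ord.
have := @polarization (X * {ptws 'I_N -> E})%type (fun q => f q.1) N us.
rewrite sus subnn leqnn /=.
move=> /(_ (fun q => f_perm q.1) (fun q => f_linear q.1)) H.
rewrite (_ : (fun p => _) =
    fun q : X * {ptws 'I_N -> E} => f q.1 [seq u q | u <- us]); last first.
  by apply/funext => q; rewrite /us -map_comp.
apply: (H _ isT _ (fun=> 0)).
- move=> z cz q; apply: (@continuous_comp _ _ _ (fun q => (q.1, z q)) _ q _ (f_diag _)).
  by apply: continuous_at_pair; [exact: cvg_fst|exact: cz].
- move=> i; have [iN|Ni] := ltnP i N; last first.
    by rewrite nth_default ?sus//; exact: cst_continuous.
  rewrite (nth_map (Ordinal iN)) ?size_enum_ord// => q.
  apply: (@continuous_comp _ _ _ snd (fun y : {ptws 'I_N -> E} => y _) q).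
    exact: cvg_snd.
  exact: proj_continuous.
- exact: cst_continuous.
Qed.

End polarization.

(** * Families of differentiable maps *)

Section families.
Context (R : realType) (E F : lcsType R) (U : lcSubset E).

Lemma near_interior_line (x : U) (h : E) (B : set U) : U° (\val x) -> nbhs x B ->
  \forall t \near (0 : R), exists z : U, [/\ U° (\val z), \val z = \val x + t *: h & B z].
Proof. by move=> Ux /(near_interior Ux)/(@lcs_cvg_line R E (\val x) h). Qed.

(** Let the parameter tend to x within X0: joint continuity makes the derivatives
    converge uniformly on short segments, as [is_dirder_limit] requires. *)
Lemma dirder_limit_dense (X : topologicalType) (X0 : set X) (g g1 : X -> U -> F) h :
  (forall x, closure X0 x) ->
  continuous (fun p : X * U => g p.1 p.2) -> continuous (fun p : X * U => g1 p.1 p.2) ->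
  (forall x (y : U), X0 x -> U° (\val y) -> is_dirder (zero_ext (g x)) (\val y) h (g1 x y)) ->
  forall x (y : U), U° (\val y) -> is_dirder (zero_ext (g x)) (\val y) h (g1 x y).
Proof.
move=> dX cg cg1 der x y Uy.
have PG : ProperFilter (within X0 (nbhs x)).
  split; last exact: within_filter.
  by move=> /= n0; have [z [X0z]] := dX x _ n0; exact.
apply: (@is_dirder_limit R E F X (within X0 (nbhs x)) (fun z => zero_ext (g z))).
  move=> A nA; have [[B C] /= [nB nC] BC] := cg1 (x, y) A nA.
  exists (B `&` X0, [set t | exists z : U, [/\ U° (\val z), \val z = \val y + t *: h & C z]]).
    split; last exact: near_interior_line.
    by rewrite /within /=; apply: filterS nB => z Bz X0z.
  move=> [z t] /= [[Bz X0z] [y' [Uy' <- Cy']]].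
  by exists (g1 z y'); [exact: (BC (z, y'))|exact: der].
have := near_interior_line h Uy (@filterT _ _ (nbhs_filter y)).
apply: filterS => t [z [Uz <- _]] A /=; rewrite zero_ext_val => nA.
have [[B C] /= [nB nC] BC] := cg (x, z) A nA.
rewrite /= nbhs_simpl /within /=; apply: filterS nB => q Bq _.
rewrite /preimage /= -[sval z]/(\val z) zero_ext_val.
by apply: (BC (q, z)); split => //; exact: nbhs_singleton.
Qed.

(** Jointly continuous maps curry to continuous maps into the compact-open
    topology. *)
Lemma near_compact_diff (X Q : topologicalType) (g : X -> Q -> F) (K : set Q)
    (A : set F) x :
  continuous (fun p : X * Q => g p.1 p.2) -> compact K -> nbhs (0 : F) A ->
  \forall z \near x, forall q, K q -> A (g z q - g x q).
Proof.
move=> cg /compact_near_coveringP cK nA.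
apply: (cK X (nbhs x) (fun z q => A (g z q - g x q))) => q Kq.
have : continuous (fun p : Q * X => g p.2 p.1 - g x p.1).
  apply: lcs_continuousB.
    exact: (continuous_compose cg (continuous_pair (@continuous_snd Q X) (@continuous_fst Q X))).
  exact: (continuous_compose cg (continuous_pair (@cst_continuous _ _ x) (@continuous_fst Q X))).
by move=> /(_ (q, x) A) /=; rewrite subrr => /(_ nA).
Qed.

(** Difference quotients converge uniformly on compact sets of parameters:
    [quotient_cvg] gives local uniformity in the parameter. *)
Lemma near_compact_quotient (Q : topologicalType) (g g1 : U -> Q -> F) (K : set Q)
    (A : set F) (x : U) h :
  continuous (fun p : U * Q => g1 p.1 p.2) -> U° (\val x) ->
  (forall (z : U) q, U° (\val z) -> is_dirder (zero_ext (g^~ q)) (\val z) h (g1 z q)) ->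
  compact K -> nbhs (0 : F) A ->
  \forall t \near (0 : R)^', forall q, K q ->
    A (t^-1 *: (zero_ext (g^~ q) (\val x + t *: h) - g x q) - g1 x q).
Proof.
move=> cg Ux der /compact_near_coveringP cK nA.
apply: (cK R 0^' (fun t q =>
  A (t^-1 *: (zero_ext (g^~ q) (\val x + t *: h) - g x q) - g1 x q))) => q Kq.
have := @sub_continuous F (g1 x q, g1 x q); rewrite /continuous_at /= subrr.
move=> /(_ _ nA) [[B C] /= [nB nC] BC].
have [|[P D] /= [nP nD] PD] := @quotient_cvg R E F Q (nbhs q)
    (fun q => zero_ext (g^~ q))
    (fun=> \val x) h (g1 x q) _ _ B nB.
  move=> A' nA'; have [[B' C'] /= [nB' nC'] BC'] := cg (x, q) A' nA'.
  exists (C', [set t | exists z : U, [/\ U° (\val z), \val z = \val x + t *: h & B' z]]).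
    by split => //; exact: near_interior_line.
  move=> [q' t] /= [Cq [z [Uz <- Bz]]].
  by exists (g1 z q'); [exact: (BC' (z, q'))|exact: der].
have nC' : nbhs q [set q' | C (g1 x q')].
  have [[B' C'] /= [nB' nC'] BC'] := cg (x, q) C nC.
  apply: filterS nC' => q' Cq'.
  by apply: (BC' (x, q')); split => //; exact: nbhs_singleton.
exists (P `&` [set q' | C (g1 x q')], D); first by split => //; exact: filterI.
move=> [q' t] /= [[Pq' Cq'] Dt]; apply: (BC (_, _)) => /=; split => //.
by have := PD (q', t) (conj Pq' Dt); rewrite /= zero_ext_val.
Qed.

End families.

(** * The topology of the spaces of differentiable maps *)

Section Cr_topology.
Context (R : realType) (E F : lcsType R) (U : lcSubset E) (r : option nat).

Lemma CrSpace_jet (f : CrSpace U r F) : jet r f (diff_jet f).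
Proof. exact/diff_jetP/Defs.Cr_mapP. Qed.

Lemma jet_unique (f : U -> F) D1 D2 (x : U) ys : jet r f D1 -> jet r f D2 ->
  leq_oo (size ys) r -> D1 x ys = D2 x ys.
Proof.
move=> j1 j2 yr; have := jet_diffk (x, seq_dirs (size ys) ys) j1 yr.
by rewrite (jet_diffk _ j2 yr) /= dirsK.
Qed.

Lemma diff_jet_lin a (f g : CrSpace U r F) (x : U) ys : leq_oo (size ys) r ->
  diff_jet (a *: f + g : CrSpace U r F) x ys = a *: diff_jet f x ys + diff_jet g x ys.
Proof.
move=> yr; exact: (@Defs.Cr_diff_lin R E U r F 
  (exist (fun k => leq_oo k r) _ yr) a f g (x, seq_dirs _ ys)).
Qed.

Lemma diff_jetD (f g : CrSpace U r F) (x : U) ys : leq_oo (size ys) r ->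
  diff_jet (f + g : CrSpace U r F) x ys = diff_jet f x ys + diff_jet g x ys.
Proof. by move=> yr; rewrite -[f in LHS]scale1r diff_jet_lin// scale1r. Qed.

Lemma diff_jetN (f : CrSpace U r F) (x : U) ys : leq_oo (size ys) r ->
  diff_jet (- f : CrSpace U r F) x ys = - diff_jet f x ys.
Proof.
move=> yr; apply: (addIr (diff_jet f x ys)); rewrite -diff_jetD// !addNr.
apply: (addIr (diff_jet (0 : CrSpace U r F) x ys)).
by rewrite -diff_jetD// !addr0 add0r.
Qed.

Lemma diff_jet0 (x : U) ys : leq_oo (size ys) r ->
  diff_jet (0 : CrSpace U r F) x ys = 0.
Proof. by move=> yr; rewrite -(subrr (0 : CrSpace U r F)) diff_jetD// diff_jetN// subrr. Qed.

Lemma diff_jetZ a (f : CrSpace U r F) (x : U) ys : leq_oo (size ys) r ->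
  diff_jet (a *: f : CrSpace U r F) x ys = a *: diff_jet f x ys.
Proof. by move=> yr; rewrite -[a *: f]addr0 diff_jet_lin// diff_jet0// addr0. Qed.

Lemma CrSpace_cvgP (G : set_system (CrSpace U r F)) (f : CrSpace U r F) : Filter G ->
  G --> f <-> forall k (K : set (U * {ptws 'I_k -> E})) (A : set F),
    leq_oo k r -> compact K -> nbhs (0 : F) A ->
    \forall g \near G, forall p, K p ->
      A (diff_jet (g : CrSpace U r F) p.1 (dirs p.2) - diff_jet f p.1 (dirs p.2)).
Proof.
move=> FG; have dE k (g : CrSpace U r F) (p : U * {ptws 'I_k -> E}) :
    diff_jet g p.1 (dirs p.2) = @diffk R E F U k g p.
  by rewrite (@diff_jetE _ _ _ _ _ _ _ k) ?size_dirs// seq_dirsK -surjective_pairing.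
have := @Defs.compact_open_initial_cvgP R _ F _ _ (@Cr_diff R E U r F)
  (@Defs.Cr_diff_continuous R E U r F) G f FG.
move=> cP; split.
  move=> /cP H k K A kr cK nA; have := H (exist (fun k => leq_oo k r) k kr) K A cK nA.
  by apply: filterS => g Hg p Kp; rewrite !dE; exact: Hg.
move=> H; apply/cP => -[k kr] K A cK nA.
have := H k K A kr cK nA; apply: filterS => g Hg p Kp.
by have := Hg p Kp; rewrite !dE.
Qed.

End Cr_topology.

(** * Currying *)

Section currying.
Context (R : realType) (E1 E2 F : lcsType R).
Context (U : lcSubset E1) (V : lcSubset E2) (r s : option nat).
Context (f : U * V -> F) (D : U -> V -> seq E1 -> seq E2 -> F).
Hypothesis jD : jet2 r s f D.

Lemma jet2_joint_continuous i j : leq_oo i r -> leq_oo j s ->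
  continuous (fun p : (U * {ptws 'I_i -> E1}) * (V * {ptws 'I_j -> E2}) =>
    D p.1.1 p.2.1 (dirs p.1.2) (dirs p.2.2)).
Proof.
move=> ir js.
pose sh (p : (U * {ptws 'I_i -> E1}) * (V * {ptws 'I_j -> E2})) :=
  ((p.1.1, p.2.1), (p.1.2, p.2.2)).
have csh : continuous sh.
  by apply: continuous_pair; apply: continuous_pair; apply: continuous_compose;
    do [exact: continuous_fst|exact: continuous_snd].
exact: (continuous_compose (jet2_continuous jD ir js) csh).
Qed.

Lemma jet2_continuous_fixed1 ws j : leq_oo (size ws) r -> leq_oo j s ->
  continuous (fun p : U * (V * {ptws 'I_j -> E2}) => D p.1 p.2.1 ws (dirs p.2.2)).
Proof.
move=> wr js; rewrite -(dirsK (erefl (size ws))).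
pose e (p : U * (V * {ptws 'I_j -> E2})) := ((p.1, seq_dirs (size ws) ws), p.2).
have ce : continuous e.
  apply: continuous_pair; last exact: continuous_snd.
  by apply: continuous_pair; [exact: continuous_fst|exact: cst_continuous].
exact: (continuous_compose (jet2_joint_continuous wr js) ce).
Qed.

Lemma jet2_continuous_fixed ws vs : leq_oo (size ws) r -> leq_oo (size vs) s ->
  continuous (fun p : U * V => D p.1 p.2 ws vs).
Proof.
move=> wr vr; rewrite -(dirsK (erefl (size vs))).
pose e (p : U * V) := (p.1, (p.2, seq_dirs (size vs) vs)).
have ce : continuous e.
  apply: continuous_pair; first exact: continuous_fst.
  by apply: continuous_pair; [exact: continuous_snd|exact: cst_continuous].
exact: (continuous_compose (jet2_continuous_fixed1 wr vr) ce).
Qed.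

Lemma near_interior2 (x : U) (y : V) (a b : E1 * E2) (B : set (U * V)) :
  U° (\val x) -> V° (\val y) -> nbhs (x, y) B ->
  \forall p \near (0 : R) & t \near (0 : R), exists z : U * V,
    [/\ U° (\val z.1), V° (\val z.2),
        (\val z.1, \val z.2) = (\val x, \val y) + p *: a + t *: b & B z].
Proof.
move=> Ux Vy [[B1 B2] /= [nB1 nB2] B12].
have [[P1 Q1] /= [nP1 nQ1] H1] := near_line2 a.1 b.1 (near_interior Ux nB1).
have [[P2 Q2] /= [nP2 nQ2] H2] := near_line2 a.2 b.2 (near_interior Vy nB2).
exists (P1 `&` P2, Q1 `&` Q2); first by split; exact: filterI.
move=> [p t] /= [[P1p P2p] [Q1t Q2t]].
have [z1 [Uz1 z1E Bz1]] := H1 (p, t) (conj P1p Q1t).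
have [z2 [Vz2 z2E Bz2]] := H2 (p, t) (conj P2p Q2t).
exists (z1, z2); split => //; last exact: (B12 (z1, z2)).
by rewrite z1E z2E.
Qed.

(** Derivatives in the second factor may also be taken after those in the first
    factor. By induction on ws, [is_dirder_exchange] on the product space moves
    v past the last direction of ws. *)
Lemma jet2_interior_dirder2 ws vs v (x : U) (y : V) :
  leq_oo (size ws) r -> leq_oo (size vs).+1 s -> U° (\val x) -> V° (\val y) ->
  is_dirder (zero_ext (fun z : V => D x z ws vs)) (\val y) v (D x y ws (rcons vs v)).
Proof.
elim/last_ind: ws x y => [|ws w IH] x y; first by move=> _; exact: (jet2_dirder2 jD).
rewrite size_rcons => wr vr Ux Vy; have wr' := leq_ooW (leqnSn _) wr.
have vr' := leq_ooW (leqnSn _) vr.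
have vr1 : leq_oo (size (rcons vs v)) s by rewrite size_rcons.
pose G ws vs := zero_ext2 (fun q : U * V => D q.1 q.2 ws vs).
apply/(is_dirder_vall (fun q => D q.1 q.2 (rcons ws w) vs)).
apply: (@is_dirder_exchange _ _ _ (G ws vs) _ (G ws (rcons vs v)) _ (w, 0)).
- have [[P Q] /= [nP nQ] PQ] :=
    near_interior2 (0, v) 0 Ux Vy (@filterT _ _ (nbhs_filter (x, y))).
  apply: filterS nP => t Pt.
  have [[x' y'] [/= Ux' Vy' + _]] := PQ (t, 0) (conj Pt (nbhs_singleton nQ)).
  rewrite /= scaler0 addr0 => <-.
  rewrite /G (zero_ext2_val _ (x', y')); apply/is_dirder_valr.
  exact: (jet2_dirder1 jD).
- apply: filterS (near_interior2 (0, v) (w, 0) Ux Vy (@filterT _ _ (nbhs_filter (x, y)))).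
  move=> p [[x' y'] [/= Ux' Vy' <- _]].
  rewrite /G (zero_ext2_val _ (x', y')); apply/is_dirder_vall.
  exact: IH.
- move=> A nA.
  have /(near_interior2 (0, v) (w, 0) Ux Vy) : nbhs (x, y)
      (fun q => A (D q.1 q.2 (rcons ws w) (rcons vs v))).
    apply: (@jet2_continuous_fixed (rcons ws w) (rcons vs v) _ vr1 (x, y)) => //.
    by rewrite size_rcons.
  apply: filterS => p [[x' y'] [/= Ux' Vy' <- A']].
  exists (D x' y' (rcons ws w) (rcons vs v)) => //.
  by apply/is_dirder_valr; exact: (jet2_dirder1 jD).
Qed.

Lemma jet2_dirder2_boundary ws vs v (x : U) (y : V) :
  leq_oo (size ws) r -> leq_oo (size vs).+1 s -> V° (\val y) ->
  is_dirder (zero_ext (fun z : V => D x z ws vs)) (\val y) v (D x y ws (rcons vs v)).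
Proof.
move=> wr vr; move: x y.
apply: (@dirder_limit_dense R E2 F V U (fun x : U => U° (\val x))
  (fun x z => D x z ws vs) (fun x z => D x z ws (rcons vs v))).
- exact: Defs.closure_interior_val.
- by apply: jet2_continuous_fixed => //; exact: leq_ooW vr.
- by apply: jet2_continuous_fixed => //; rewrite size_rcons.
- by move=> x y Ux Vy; exact: jet2_interior_dirder2.
Qed.

Lemma jet2_dirder1_boundary ws vs w (x : U) (y : V) :
  leq_oo (size ws).+1 r -> leq_oo (size vs) s -> U° (\val x) ->
  is_dirder (zero_ext (fun z : U => D z y ws vs)) (\val x) w (D x y (rcons ws w) vs).
Proof.
move=> wr vr; move: y x.
have cswap (g : U -> V -> F) : continuous (fun p : U * V => g p.1 p.2) ->
    continuous (fun p : V * U => g p.2 p.1).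
  move=> cg.
  exact: (continuous_compose cg (continuous_pair (@continuous_snd V U) (@continuous_fst V U))).
apply: (@dirder_limit_dense R E1 F U V (fun y : V => V° (\val y))
  (fun y z => D z y ws vs) (fun y z => D z y (rcons ws w) vs)).
- exact: Defs.closure_interior_val.
- by apply: (cswap (fun x y => D x y ws vs));
    apply: jet2_continuous_fixed => //; exact: leq_ooW wr.
- apply: (cswap (fun x y => D x y (rcons ws w) vs)).
  by apply: jet2_continuous_fixed => //; rewrite size_rcons.
- by move=> y x Vy Ux; exact: (jet2_dirder1 jD).
Qed.

Lemma jet2_slice ws (x : U) : leq_oo (size ws) r ->
  jet s (fun y => D x y ws [::]) (fun y vs => D x y ws vs).
Proof.
move=> wr; split => //.
- move=> j js.
  have cx : continuous (fun p : V * {ptws 'I_j -> E2} => (x, p)).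
    by apply: continuous_pair; [exact: cst_continuous|move=> p; exact: cvg_id].
  exact: (continuous_compose (jet2_continuous_fixed1 wr js) cx).
- by move=> y vs v vr Vy; exact: jet2_dirder2_boundary.
Qed.

(** The candidate for the derivatives of the curried map. [insubd]
    gives 0 if y |-> D x y ws [::] is not C^s, which only happens for ws longer
    than r. *)
Definition curry_jet (x : U) (ws : seq E1) : CrSpace V s F :=
  insubd (0 : CrSpace V s F) (fun y => D x y ws [::]).

Lemma curry_jetE x ws : leq_oo (size ws) r ->
  curry_jet x ws = (fun y => D x y ws [::]) :> (V -> F).
Proof.
move=> wr; apply: (@insubdK _ _ (CrSpace V s F)).
by apply/mem_set/jet_Cr_map; exact: jet2_slice.
Qed.

Lemma diff_curry_jet x ws y vs : leq_oo (size ws) r -> leq_oo (size vs) s ->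
  diff_jet (curry_jet x ws) y vs = D x y ws vs.
Proof.
move=> wr vr; have := CrSpace_jet (curry_jet x ws); rewrite curry_jetE// => jc.
exact: (jet_unique _ jc (jet2_slice x wr) vr).
Qed.

(** Convergence in C^s(V, F) is uniform convergence on compact sets of all
    derivatives in the second factor, so that both the continuity and the
    differentiability of the curried map reduce to compact sets of parameters
    (y, vs). *)
Lemma curry_jetP : jet r (fun x => curry_jet x [::]) curry_jet.
Proof.
split => //.
- move=> i ir [x w].
  apply/CrSpace_cvgP => j K A js cK nA.
  have := @near_compact_diff R F (U * {ptws 'I_i -> E1})%type (V * {ptws 'I_j -> E2})%type
    (fun p q => D p.1 q.1 (dirs p.2) (dirs q.2)) K A (x, w)
    (jet2_joint_continuous ir js) cK nA.
  apply: filterS => -[x' w'] H p Kp; rewrite !diff_curry_jet ?size_dirs//.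
  exact: H.
- move=> x; move: (x : U) => {}x ws w wr Ux; apply/CrSpace_cvgP => j K A js cK nA.
  have wr' := leq_ooW (leqnSn _) wr.
  have wr1 : leq_oo (size (rcons ws w)) r by rewrite size_rcons.
  have nx : \forall t \near (0 : R)^', exists z : U,
      [/\ U° (\val z), \val z = \val x + t *: w & True].
    have /nbhs_dnbhs := near_interior_line w Ux (@filterT _ _ (nbhs_filter x)).
    by apply: filterS => t [z [Uz zE _]]; exists z.
  have nq := @near_compact_quotient R E1 F U (V * {ptws 'I_j -> E2})%type
    (fun (x : U) q => D x q.1 ws (dirs q.2))
    (fun (x : U) q => D x q.1 (rcons ws w) (dirs q.2))
    K A x w (jet2_continuous_fixed1 wr1 js) Ux _ cK nA.
  apply: filterS2 nx (nq _).
    move=> t [z [Uz zE _]] Ht q Kq; have := Ht q Kq.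
    rewrite -!zE !zero_ext_val diff_jetZ ?size_dirs//.
    rewrite diff_jetD ?size_dirs// diff_jetN ?size_dirs//.
    by rewrite !diff_curry_jet ?size_dirs.
  by move=> z q Uz; apply: jet2_dirder1_boundary; rewrite ?size_dirs.
Qed.

End currying.

(** * The exponential map is an embedding *)

Section exponential_map.
Context (R : realType) (E1 E2 F : lcsType R).
Context (U : lcSubset E1) (V : lcSubset E2) (r s : option nat).
Implicit Types f g : CrsSpace U V r s F.

Local Notation dirpairs i j := ({ptws 'I_i -> E1} * {ptws 'I_j -> E2})%type.

Lemma CrsSpace_jet f : jet2 r s f (diff_jet2 f).
Proof. exact/diff_jet2P/Defs.Crs_mapP. Qed.

Lemma CrsSpace_cvgP (G : set_system (CrsSpace U V r s F)) f : Filter G ->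
  G --> f <-> forall i j (K : set ((U * V) * dirpairs i j)) (A : set F),
    leq_oo i r -> leq_oo j s -> compact K -> nbhs (0 : F) A ->
    \forall g \near G, forall p, K p ->
      A (diff_jet2 (g : CrsSpace U V r s F) p.1.1 p.1.2 (dirs p.2.1) (dirs p.2.2) -
         diff_jet2 f p.1.1 p.1.2 (dirs p.2.1) (dirs p.2.2)).
Proof.
move=> FG; have dE i j g (p : (U * V) * dirpairs i j) :
    diff_jet2 g p.1.1 p.1.2 (dirs p.2.1) (dirs p.2.2) =
    @diffk2 R E1 E2 F U V i j g p.
  rewrite (@diff_jet2E _ _ _ _ _ _ _ _ _ _ _ i j) ?size_dirs// !seq_dirsK.
  by case: p => -[? ?] [? ?].
have := @Defs.compact_open_initial_cvgP R _ F _ _ (@Crs_diff R E1 E2 U V r s F)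
  (@Defs.Crs_diff_continuous R E1 E2 U V r s F) G f FG.
move=> cP; split.
  move=> /cP H i j K A ir js cK nA.
  have := H (exist (fun k => leq_oo k r) i ir, exist (fun k => leq_oo k s) j js) K A cK nA.
  by apply: filterS => g Hg p Kp; rewrite !dE; exact: Hg.
move=> H; apply/cP => -[[i ir] [j js]] K A cK nA.
have := H i j K A ir js cK nA; apply: filterS => g Hg p Kp.
by have := Hg p Kp; rewrite !dE.
Qed.

Definition exponential f : CrSpace U r (CrSpace V s F) :=
  MkCrSpace (mem_set (jet_Cr_map (curry_jetP (CrsSpace_jet f)))).

Lemma exponentialE f x y : exponential f x y = f (x, y).
Proof.
have [r0 s0] : leq_oo 0 r /\ leq_oo 0 s by case: r s => [?|] [?|].
by rewrite /= (curry_jetE (CrsSpace_jet f) x (ws := [::]))// (jet20 (CrsSpace_jet f)).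
Qed.

Lemma diff_exponential f x ws y vs : leq_oo (size ws) r -> leq_oo (size vs) s ->
  diff_jet (diff_jet (exponential f) x ws : CrSpace V s F) y vs = diff_jet2 f x y ws vs.
Proof.
move=> wr vr.
have jc : jet r (exponential f) (curry_jet s (diff_jet2 f)).
  exact: (curry_jetP (CrsSpace_jet f)).
rewrite (jet_unique _ (CrSpace_jet _) jc wr).
exact: (diff_curry_jet (CrsSpace_jet f)).
Qed.

Lemma exponential_is_linear : linear exponential.
Proof.
move=> a f g; apply/val_inj/funext => x; apply/val_inj/funext => y.
by rewrite -[LHS]/(exponential (a *: f + g) x y) exponentialE
  -[RHS]/(a *: exponential f x y + exponential g x y) !exponentialE.
Qed.

HB.instance Definition _ := GRing.isLinear.Build R (CrsSpace U V r s F)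
  (CrSpace U r (CrSpace V s F)) _ exponential exponential_is_linear.

Lemma exponential_inj : injective exponential.
Proof.
move=> f g fg; apply/val_inj/funext => -[x y].
by rewrite -[LHS]/(f (x, y)) -[RHS]/(g (x, y)) -!exponentialE fg.
Qed.

(** The derivatives of the curried map are those of f, with the arguments
    regrouped. The left-hand side is thus uniform convergence on compact sets of
    quadruples (x, y, w, v), and the right-hand side is uniform convergence on
    products of a compact set of pairs (x, w) with one of pairs (y, v). Such
    products are compact, and every compact set lies in the product of its
    projections. *)
Lemma exponential_cvgP (G : set_system (CrsSpace U V r s F)) f : Filter G ->
  G --> f <-> exponential @ G --> exponential f.
Proof.
move=> FG; split.
  move=> /CrsSpace_cvgP Gf; apply/CrSpace_cvgP => i L N ir cL nN.
  (* [CrSpace_cvgP] describes convergence rather than neighbourhoods: the claim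
     about N becomes the convergence to 0 of the filter of all N satisfying it. *)
  pose H : set_system (CrSpace V s F) := [set N | \forall g \near G, forall p, L p ->
    N (diff_jet (exponential g) p.1 (dirs p.2) -
       diff_jet (exponential f) p.1 (dirs p.2))].
  have FH : Filter H.
    split.
    - by apply: (@filterS _ G _ setT) => //; exact: filterT.
    - move=> A B HA HB; apply: (@filterS2 _ G _ _ _ _ _ HA HB) => g Ag Bg p Lp.
      by split; [exact: Ag|exact: Bg].
    - by move=> A B AB; apply: (@filterS _ G) => g Ag p Lp; exact/AB/Ag.
  suff : H --> (0 : CrSpace V s F) by apply.
  apply/CrSpace_cvgP => j M A js cM nA.
  pose sh (p : (U * {ptws 'I_i -> E1}) * (V * {ptws 'I_j -> E2})) :=
    ((p.1.1, p.2.1), (p.1.2, p.2.2)).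
  have csh : continuous sh.
    by apply: continuous_pair; apply: continuous_pair; apply: continuous_compose;
      do [exact: continuous_fst|exact: continuous_snd].
  have cK : compact (sh @` (L `*` M)).
    apply: continuous_compact; last exact: compact_setX.
    exact: continuous_subspaceT.
  have := Gf i j _ A ir js cK nA.
  apply: filterS => g Hg p Lp q Mq.
  rewrite diff_jetD ?size_dirs// diff_jetN ?size_dirs// diff_jet0 ?size_dirs// subr0.
  rewrite !diff_exponential ?size_dirs//.
  by apply: (Hg (sh (p, q))); exists (p, q).
move=> /CrSpace_cvgP Gf; apply/CrsSpace_cvgP => i j K A ir js cK nA.
have cL : continuous (fun p : (U * V) * dirpairs i j => (p.1.1, p.2.1)).
  by apply: continuous_pair; apply: continuous_compose;
      do [exact: continuous_fst|exact: continuous_snd].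
have cM : continuous (fun p : (U * V) * dirpairs i j => (p.1.2, p.2.2)).
  by apply: continuous_pair; apply: continuous_compose;
      do [exact: continuous_fst|exact: continuous_snd].
have {}cL := continuous_compact (continuous_subspaceT cL) cK.
have {}cM := continuous_compact (continuous_subspaceT cM) cK.
have /CrSpace_cvgP/(_ j _ A js cM nA) nN := @cvg_refl _ (nbhs (0 : CrSpace V s F)).
have := Gf i _ _ ir cL nN; apply: (@filterS _ G) => g Hg p Kp.
have := Hg _ (ex_intro2 _ _ p Kp erefl) _ (ex_intro2 _ _ p Kp erefl).
rewrite diff_jetD ?size_dirs// diff_jetN ?size_dirs// diff_jet0 ?size_dirs// subr0.
by rewrite !diff_exponential ?size_dirs.
Qed.

Lemma exponential_continuous : continuous exponential.
Proof.
by move=> f; exact: ((@exponential_cvgP (nbhs f) f (nbhs_filter f)).1 (@cvg_refl _ _)).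
Qed.

Lemma exponential_embedding : topological_embedding exponential.
Proof.
split; [exact: exponential_inj|exact: exponential_continuous|].
move=> A oA; pose Bs := [set B | open B /\ exponential @^-1` B `<=` A].
exists (\bigcup_(B in Bs) B); first by apply: bigcup_open => B [].
apply/seteqP; split.
  move=> _ [f Af <-]; split; first by exists f.
  (* the filter of preimages of neighbourhoods converges to f *)
  pose G : set_system (CrsSpace U V r s F) :=
    filter_from (nbhs (exponential f)) (fun N => exponential @^-1` N).
  have FG : Filter G.
    apply: filter_from_filter; first by exists setT; exact: filterT.
    by move=> M N nM nN; exists (M `&` N) => //; exact: filterI.
  have /exponential_cvgP Gf : exponential @ G --> exponential f.
    by move=> N nN; exists N.
  have [N nN NA] := Gf A (open_nbhs_nbhs (conj oA Af)).
  exists N°; last exact: nbhs_singleton (nbhs_interior nN).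
  split; first exact: open_interior.
  by move=> g /interior_subset Ng; exact: NA.
by move=> _ [[f _ <-] [B [oB BA] Bf]]; exists f => //; exact: BA.
Qed.

End exponential_map.

(** * Uncurrying *)

Section evaluation.
Context (R : realType) (E F : lcsType R) (V : lcSubset E) (s : option nat).

(** Points are compact. *)
Lemma eval_jet_continuous y vs : leq_oo (size vs) s ->
  continuous (fun h : CrSpace V s F => diff_jet h y vs).
Proof.
move=> vr h A /Defs.nbhs0_shift nA.
have /(CrSpace_cvgP _ (nbhs_filter h)) ch := @cvg_refl _ (nbhs h).
have := ch _ _ _ vr (@compact_set1 _ (y, seq_dirs (size vs) vs)) nA.
apply: (@filterS _ _ (nbhs_filter h)) => g /(_ _ erefl) /=.
by rewrite dirsK// addrC subrK.
Qed.

Lemma is_dirder_eval (E1 : lmodType R) (g : E1 -> CrSpace V s F) x h l y vs :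
  leq_oo (size vs) s -> is_dirder g x h l ->
  is_dirder (fun z => diff_jet (g z) y vs) x h (diff_jet l y vs).
Proof.
move=> vr gl; have := cvg_comp _ _ gl (@eval_jet_continuous y vs vr l).
apply: cvg_trans; apply: near_eq_cvg; apply: nearW => t.
rewrite -[LHS]/(diff_jet (t^-1 *: (g (x + t *: h) - g x) : CrSpace V s F) y vs).
by rewrite diff_jetZ// diff_jetD// diff_jetN.
Qed.

(** Evaluation is jointly continuous once the point stays in a compact set,
    because u converges uniformly there. *)
Lemma near_eval_compact (P : topologicalType) (u : P -> CrSpace V s F) j p
    (q : V * {ptws 'I_j -> E}) (M : set (V * {ptws 'I_j -> E})) (A : set F) :
  leq_oo j s -> continuous u -> compact M ->
  nbhs (diff_jet (u p) q.1 (dirs q.2)) A ->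
  \forall p' \near p & q' \near q, M q' -> A (diff_jet (u p') q'.1 (dirs q'.2)).
Proof.
move=> js cu cM /Defs.nbhs0_shift/Defs.nbhs0_split[B nB BA].
have /(CrSpace_cvgP _ (nbhs_filter (u p))) ch := @cvg_refl _ (nbhs (u p)).
have nP := cu p _ (ch _ _ _ js cM nB).
have nQ := jet_continuous (CrSpace_jet (u p)) js
  (Defs.nbhs_shift (diff_jet (u p) q.1 (dirs q.2)) nB).
exists ([set p' | forall q', M q' ->
    B (diff_jet (u p') q'.1 (dirs q'.2) - diff_jet (u p) q'.1 (dirs q'.2))],
  [set q' | B (diff_jet (u p) q'.1 (dirs q'.2) - diff_jet (u p) q.1 (dirs q.2))]).
  by split.
move=> [p' q'] /= [Hp' Bq'] Mq'.
by have := BA _ _ (Hp' _ Mq') Bq'; 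
  rewrite /= [X in A (_ + X)]addrA subrK [X in A X]addrC subrK.
Qed.

End evaluation.

Section locally_compact_case.
Context (R : realType) (E F : lcsType R) (V : lcSubset E).
Hypothesis lcV : locally_compact [set: V].

Lemma locally_compact_nbhs (y : V) : exists2 K : set V, nbhs y K & compact K.
Proof.
have [K nK [cK _]] := lcV (I : [set: V] y); exists K => //.
by apply: (@filterS _ _ (nbhs_filter y) _ _ _ nK) => z; exact.
Qed.

(** If V has a point, it has an interior point, and a compact neighbourhood of
    the latter can be translated anywhere in E. *)
Lemma locally_compact_space (y : V) (e : E) : exists2 K : set E, nbhs e K & compact K.
Proof.
have [y0 [Vy0 _]] := Defs.closure_interior_val (@filterT _ _ (nbhs_filter y)).
have [K nK cK] := locally_compact_nbhs y0.
have cvK : compact ((fun z : V => \val z - \val y0 + e) @` K).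
  apply: continuous_compact => //; apply: continuous_subspaceT.
  apply: lcs_continuousD; last exact: cst_continuous.
  by apply: lcs_continuousB; [exact: val_continuous|exact: cst_continuous].
exists ((fun z : V => \val z - \val y0 + e) @` K) => //.
have := Defs.nbhs_shift e (Defs.nbhs0_shift (near_interior Vy0 nK)).
apply: filterS => w /= [z [_ zE Kz]]; exists z => //.
by rewrite zE [_ + (w - e)]addrC addrK subrK.
Qed.

(** Evaluation on C(V x E^j, F) is what has to be continuous, so that compact
    neighbourhoods are needed in V x E^j and not just in V. *)
Lemma locally_compact_dirs j (q : V * {ptws 'I_j -> E}) :
  exists2 M, nbhs q M & compact M.
Proof.
case: q => y v.
have [K nK cK] := locally_compact_nbhs y.
have /choice[L HL] i : exists L : set E, nbhs (v i) L /\ compact L.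
  by have [L nL cL] := locally_compact_space y (v i); exists L.
have cL : compact [set w : {ptws 'I_j -> E} | forall i, L i (w i)].
  by apply: (@tychonoff 'I_j (fun=> E)) => i; have [] := HL i.
exists (K `*` [set w : {ptws 'I_j -> E} | forall i, L i (w i)]); last exact: compact_setX.
exists (K, [set w : {ptws 'I_j -> E} | forall i, L i (w i)]) => //; split => //=.
apply: (@filter_forall {ptws 'I_j -> E} 'I_j (fun i w => L i (w i)) (nbhs v)) => i.
have [nL _] := HL i.
exact: (@proj_continuous 'I_j (fun=> E) i v _ nL).
Qed.

End locally_compact_case.

Section uncurrying.
Context (R : realType) (E1 E2 F : lcsType R).
Context (U : lcSubset E1) (V : lcSubset E2) (r s : option nat).
Context (eta : CrSpace U r (CrSpace V s F)).

(** The candidate for the derivatives of (x, y) |-> eta x y. They are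
    derivatives because evaluation of a derivative at (y, vs) is a continuous
    linear map on C^s(V, F); the joint continuity is the delicate point. *)
Definition uncurry_jet (x : U) (y : V) ws vs : F :=
  diff_jet (diff_jet eta x ws : CrSpace V s F) y vs.

Lemma uncurry_locally_compact i j : leq_oo i r -> leq_oo j s ->
  locally_compact [set: V] ->
  continuous (fun p : (U * V) * ({ptws 'I_i -> E1} * {ptws 'I_j -> E2}) =>
    uncurry_jet p.1.1 p.1.2 (dirs p.2.1) (dirs p.2.2)).
Proof.
move=> ir js lcV.
have c : continuous (fun p : (U * {ptws 'I_i -> E1}) * (V * {ptws 'I_j -> E2}) =>
    uncurry_jet p.1.1 p.2.1 (dirs p.1.2) (dirs p.2.2)).
  move=> [p q] A nA; have [M nM cM] := locally_compact_dirs lcV q.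
  have [[B C] /= [nB nC] BC] := near_eval_compact js
    (jet_continuous (CrSpace_jet eta) ir) cM nA.
  exists (B, C `&` M); first by split => //; exact: filterI.
  by move=> [p' q'] /= [Bp' [Cq' Mq']]; exact: (BC (p', q')).
pose sh (p : (U * V) * ({ptws 'I_i -> E1} * {ptws 'I_j -> E2})) :=
  ((p.1.1, p.2.1), (p.1.2, p.2.2)).
have csh : continuous sh.
  by apply: continuous_pair; apply: continuous_pair; apply: continuous_compose;
    do [exact: continuous_fst|exact: continuous_snd].
exact: (continuous_compose c csh).
Qed.

Lemma nseq_dirs (E : Type) n (v : E) : dirs (fun _ : 'I_n => v) = nseq n v.
Proof.
rewrite /dirs -[in RHS](size_enum_ord n).
by elim: (enum 'I_n) => //= a l ->.
Qed.

Lemma const_continuous (E : topologicalType) n :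
  continuous (fun v : E => (fun _ : 'I_n => v) : {ptws 'I_n -> E}).
Proof.
move=> v; apply/cvg_sup => i N [_ [[W oW <-] Wv] WN].
apply: (@filterS _ _ (nbhs_filter v) W); first by move=> w Ww; exact: WN.
exact: open_nbhs_nbhs.
Qed.

(** On a compact set K of quadruples, the points at which the derivatives of
    [eta x] are evaluated lie in the compact image of K under b, so that
    [near_eval_compact] gives continuity on K. *)
Lemma uncurry_diagonal_k_space i j : leq_oo i r -> leq_oo j s ->
  k_space (U * V * E1 * E2)%type ->
  continuous (fun p : (U * V) * E1 * E2 =>
    uncurry_jet p.1.1.1 p.1.1.2 (nseq i p.1.2) (nseq j p.2)).
Proof.
move=> ir js [_ kX].
set H := fun p => _.
pose a (p : (U * V) * E1 * E2) : U * {ptws 'I_i -> E1} :=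
  (p.1.1.1, fun=> p.1.2).
pose b (p : (U * V) * E1 * E2) : V * {ptws 'I_j -> E2} :=
  (p.1.1.2, fun=> p.2).
have ca : continuous a.
  apply: continuous_pair.
    do 2 (apply: continuous_compose; first exact: continuous_fst).
    exact: continuous_fst.
  apply: (continuous_compose (@const_continuous E1 i)).
  by apply: continuous_compose; [exact: continuous_snd|exact: continuous_fst].
have cb : continuous b.
  apply: continuous_pair.
    apply: continuous_compose; first exact: continuous_snd.
    by apply: continuous_compose; exact: continuous_fst.
  by apply: (continuous_compose (@const_continuous E2 j)); exact: continuous_snd.
have HE p : H p = diff_jet (diff_jet eta (a p).1 (dirs (a p).2) : CrSpace V s F)
    (b p).1 (dirs (b p).2) by rewrite /H /uncurry_jet /a /b /= !nseq_dirs.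
apply/continuousP => A oA; apply/kX => K cK.
rewrite openE => z /= Az.
have cM := continuous_compact (continuous_subspaceT cb) cK.
have nA : nbhs (H (set_val z)) A by exact: open_nbhs_nbhs.
rewrite HE in nA.
have [[B C] /= [nB nC] BC] := near_eval_compact js
    (jet_continuous (CrSpace_jet eta) ir) cM nA.
have nz : \forall w \near z, B (a (set_val w)) /\ C (b (set_val w)).
  apply: filterI.
    exact: (continuous_compose ca (@initial_continuous _ _ _) nB).
  exact: (continuous_compose cb (@initial_continuous _ _ _) nC).
apply: filterS nz => w [Bw Cw]; rewrite /preimage /= HE.
apply: (BC (_, _)) => //=; exists (set_val w) => //; exact: set_valP.
Qed.

(** The hypothesis concerns E1 x E2 and not the powers of E1 and E2, so that it
    only gives continuity for equal directions in each factor. The derivatives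
    being symmetric and multilinear, polarization in the second and then in the
    first factor gives the rest. *)
Lemma uncurry_k_space i j : leq_oo i r -> leq_oo j s ->
  k_space (U * V * E1 * E2)%type ->
  continuous (fun p : (U * V) * ({ptws 'I_i -> E1} * {ptws 'I_j -> E2}) =>
    uncurry_jet p.1.1 p.1.2 (dirs p.2.1) (dirs p.2.2)).
Proof.
move=> ir js kX.
have c1 := @continuous_polarization R E2 F (U * V * E1)%type
  (fun x vs => uncurry_jet x.1.1 x.1.2 (nseq i x.2) vs) j.
have {}c1 := c1 _ _ (uncurry_diagonal_k_space ir js kX).
have {}c1 : continuous (fun p : U * V * E1 * {ptws 'I_j -> E2} =>
    uncurry_jet p.1.1.1 p.1.1.2 (nseq i p.1.2) (dirs p.2)).
  apply: c1 => [x s1 s2 s1j|x l a b c lj].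
    by apply: (jet_perm (CrSpace_jet _)); rewrite s1j.
  by apply: (jet_linear (CrSpace_jet _)); rewrite lj.
have c2 := @continuous_polarization R E1 F (U * V * {ptws 'I_j -> E2})%type
  (fun x ws => uncurry_jet x.1.1 x.1.2 ws (dirs x.2)) i.
have {}c2 : continuous (fun p : U * V * {ptws 'I_j -> E2} * {ptws 'I_i -> E1} =>
    uncurry_jet p.1.1.1 p.1.1.2 (dirs p.2) (dirs p.1.2)).
  apply: c2 => [x s1 s2 s1i s12|x l a b c li|].
  - by rewrite /uncurry_jet (jet_perm (CrSpace_jet eta) _ _ s12)// s1i.
  - rewrite /uncurry_jet (jet_linear (CrSpace_jet eta)) ?li//.
    by rewrite diff_jetD ?diff_jetZ ?size_dirs.
  - pose sh (p : U * V * {ptws 'I_j -> E2} * E1) := (p.1.1, p.2, p.1.2).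
    have csh : continuous sh.
      apply: continuous_pair; last first.
        by apply: continuous_compose; [exact: continuous_snd|exact: continuous_fst].
      apply: continuous_pair; last exact: continuous_snd.
      by apply: continuous_compose; exact: continuous_fst.
    exact: (continuous_compose c1 csh).
pose sh (p : (U * V) * ({ptws 'I_i -> E1} * {ptws 'I_j -> E2})) :=
  (p.1, p.2.2, p.2.1).
have csh : continuous sh.
  apply: continuous_pair.
    apply: continuous_pair; first exact: continuous_fst.
    by apply: continuous_compose; exact: continuous_snd.
  by apply: continuous_compose; [exact: continuous_fst|exact: continuous_snd].
exact: (continuous_compose c2 csh).
Qed.

Lemma uncurry_jetP :
  k_space (U * V * E1 * E2)%type \/ locally_compact [set: V] ->
  jet2 r s (fun p => eta p.1 p.2) uncurry_jet.
Proof.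
move=> kl; have jeta := CrSpace_jet eta; split.
- move=> x y; rewrite /uncurry_jet (jet0 jeta).
  exact: (jet0 (CrSpace_jet (eta x))).
- move=> i j ir js; case: kl => [kX|lcV].
    exact: uncurry_k_space.
  exact: uncurry_locally_compact.
- by move=> x y vs v vr _ Vy; exact: (jet_dirder (CrSpace_jet _)).
- move=> x y ws vs w wr vr Ux _.
  have := is_dirder_eval (y := y) vr (jet_dirder jeta wr Ux (h := w)).
  apply: (Defs.is_dirder_eq (open_interior U)) => // z /set_mem.
  by move: z; apply: interior_ind => z _; rewrite !zero_ext_val.
Qed.

End uncurrying.

(** * The exponential law *)

(** Uncurrying is inverse to [exponential], and [exponential_cvgP] makes its
    continuity automatic. *)
Lemma exponential_isomorphism (R : realType) (E1 E2 F : lcsType R)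
    (U : lcSubset E1) (V : lcSubset E2) (r s : option nat) :
  k_space (U * V * E1 * E2)%type \/ locally_compact [set: V] ->
  tvs_isomorphism (@exponential R E1 E2 F U V r s :
    {linear CrsSpace U V r s F -> CrSpace U r (CrSpace V s F)}).
Proof.
move=> kl.
pose uncurry (eta : CrSpace U r (CrSpace V s F)) : CrsSpace U V r s F :=
  MkCrsSpace (mem_set (jet2_Crs_map (uncurry_jetP eta kl))).
have expK : cancel uncurry (@exponential R E1 E2 F U V r s).
  move=> eta; apply/val_inj/funext => x; apply/val_inj/funext => y.
  exact: exponentialE.
have unK : cancel (@exponential R E1 E2 F U V r s) uncurry.
  by move=> f; apply: exponential_inj; rewrite expK.
exists uncurry; split => //; first exact: exponential_continuous.
move=> eta; apply/(@exponential_cvgP R E1 E2 F U V r s (uncurry @ nbhs eta)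
  (uncurry eta) (fmap_filter _ (nbhs_filter eta))).
rewrite expK => N nN; rewrite /= nbhs_simpl.
by apply: (@filterS _ _ (nbhs_filter eta) _ _ _ nN) => z; rewrite /preimage /= expK.
Qed.

Unset Implicit Arguments.

Theorem theoremA (R : realType) (E1 E2 F : lcsType R)
    (U : lcSubset E1) (V : lcSubset E2) (r s : option nat) :
  (forall gamma : CrsSpace U V r s F,
     exists2 gamma_check : U -> CrSpace V s F,
       (forall (x : U) (y : V), gamma_check x y = gamma (x, y)) &
       Cr_map r gamma_check) /\
  exists Phi : {linear CrsSpace U V r s F -> CrSpace U r (CrSpace V s F)},
    [/\ forall gamma (x : U) (y : V), Phi gamma x y = gamma (x, y),
        topological_embedding Phi &
        k_space (U * V * E1 * E2)%type \/ locally_compact [set: V] ->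
        tvs_isomorphism Phi].
Proof.
split=> [gamma|].
  exists (exponential gamma); first exact: exponentialE.
  exact: Defs.Cr_mapP.
exists (@exponential R E1 E2 F U V r s); split.
- exact: exponentialE.
- exact: exponential_embedding.
- exact: exponential_isomorphism.
Qed.
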